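(* Let $J:=\operatorname{conv}\{\mathbf{v}_0,\mathbf{v}_1,\dots,\mathbf{v}_d\}\subset\mathbb{R}^d_{\ge 0}\setminus\{\mathbf{0}\}$ be a $d$-simplex and let $f$ be continuous and convex on $J$. Then $$\operatorname{vol}(P(f,J))=\frac{1}{(d+2)!}\left|\det\begin{bmatrix}\mathbf{v}_0&\mathbf{v}_1&\dots&\mathbf{v}_d\\ 1&1&\dots&1\end{bmatrix}\right|\sum_{j=0}^d f(\mathbf{v}_j)-\frac{1}{d+2}\int_J f(\mathbf{x})\,d\mathbf{x}.$$
   Context: Let $\mu:\mathbb{R}^d\to\mathbb{R}$ be the unique affine function agreeing with $f$ at the vertices $\mathbf{v}_0,\dots,\mathbf{v}_d$ of $J$, and let $\mu(\mathbf{x},z):=z\,\mu(\mathbf{x}/z)$ (which extends to a linear function of $(\mathbf{x},z)$). For $z\ge 0$, $z\cdot J:=\{z\mathbf{x}:\mathbf{x}\in J\}$. The perspective relaxation is $$P(f,J):=\operatorname{cl}\{(\mathbf{x},y,z)\in\mathbb{R}^d\times\mathbb{R}\times\mathbb{R}:\ \mu(\mathbf{x},z)\ge y\ge z f(\mathbf{x}/z),\ \mathbf{x}\in z\cdot J,\ 1\ge z>0\}.$$ $\operatorname{vol}$ denotes $(d+2)$-dimensional Lebesgue measure. *)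

(* Defs.v *)
From mathcomp Require Import all_boot all_order all_algebra.
From mathcomp Require Import all_classical all_reals all_analysis.
Set Implicit Arguments. Unset Strict Implicit. Unset Printing Implicit Defensive.
Import Order.TTheory GRing.Theory Num.Theory.
Local Open Scope ring_scope.
Local Open Scope classical_set_scope.

(* Points of R^n are n-tuples of reals; [n.-tuple R] carries the product
   (= Borel) sigma-algebra of mathcomp-analysis (measurable_structure.v). *)

Section Defs.
Variable R : realType.

(* A measure on R^n is "the" n-dimensional Lebesgue measure (on Borel sets)
   iff it assigns to every closed box its volume.  (Lebesgue measure on the
   Borel sets exists and is uniquely determined by this property.) *)
Definition is_lebesgue (n : nat) (m : {measure set (n.-tuple R) -> \bar R}) :=
  forall a b : n.-tuple R, (forall i, tnth a i <= tnth b i) ->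
    m [set x | forall i, tnth a i <= tnth x i <= tnth b i]
    = (\prod_(i < n) (tnth b i - tnth a i))%:E.

Definition tscale (n : nat) (z : R) (x : n.-tuple R) : n.-tuple R :=
  [tuple z * tnth x i | i < n].
Definition tcomb (n : nat) (t : R) (x y : n.-tuple R) : n.-tuple R :=
  [tuple t * tnth x i + (1 - t) * tnth y i | i < n].

Definition conv_hull (d : nat) (v : 'I_d.+1 -> d.-tuple R) : set (d.-tuple R) :=
  [set x | exists lam : 'I_d.+1 -> R,
     [/\ (forall j, 0 <= lam j), \sum_(j < d.+1) lam j = 1 &
         forall i, tnth x i = \sum_(j < d.+1) lam j * tnth (v j) i]].

Definition vertex_matrix (d : nat) (v : 'I_d.+1 -> d.-tuple R) : 'M[R]_d.+1 :=
  \matrix_(i < d.+1, j < d.+1) (if (i < d)%N then nth 0 (v j : seq R) i else 1).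

Definition dilate (n : nat) (z : R) (J : set (n.-tuple R)) : set (n.-tuple R) :=
  [set tscale z x | x in J].

Definition pt (d : nat) (x : d.-tuple R) (y z : R) : (d.+2).-tuple R :=
  [tuple (if (i < d)%N then nth 0 (x : seq R) i
          else if (i : nat) == d then y else z) | i < d.+2].

(* topological closure in R^n (all norms on R^n are equivalent; sup-norm) *)
Definition tclosure (n : nat) (A : set (n.-tuple R)) : set (n.-tuple R) :=
  [set p | forall e : R, 0 < e ->
     exists q, A q /\ forall i, `|tnth p i - tnth q i| < e].

(* perspective relaxation P(f,J); mu is the affine interpolant of f *)
Definition persp_relax (d : nat) (f mu : d.-tuple R -> R)
    (J : set (d.-tuple R)) : set (d.+2.-tuple R) :=
  tclosure [set p | exists (x : d.-tuple R) (y z : R),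
     [/\ p = pt x y z,
         z * mu (tscale z^-1 x) >= y, y >= z * f (tscale z^-1 x),
         dilate z J x & 0 < z <= 1]].

Definition continuous_on_set (n : nat) (J : set (n.-tuple R)) (f : n.-tuple R -> R) :=
  forall x, J x -> forall e : R, 0 < e -> exists2 delta : R, 0 < delta &
    forall y, J y -> (forall i, `|tnth x i - tnth y i| < delta) -> `|f x - f y| < e.

Definition convex_on_set (n : nat) (J : set (n.-tuple R)) (f : n.-tuple R -> R) :=
  forall x y (t : R), J x -> J y -> 0 <= t <= 1 ->
    f (tcomb t x y) <= t * f x + (1 - t) * f y.

Definition affine_fun (n : nat) (mu : n.-tuple R -> R) :=
  exists (c : n.-tuple R) (b : R), forall x, mu x = \sum_(i < n) tnth c i * tnth x i + b.

End Defs.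

(* Main.v *)
Require Import Defs.
From HB Require Import structures.
From mathcomp Require Import all_boot all_order fingroup perm all_algebra.
From mathcomp Require Import all_classical all_reals all_analysis.
From mathcomp Require Import measurable_realfun ring.
Import Order.TTheory GRing.Theory Num.Theory.
Import numFieldNormedType.Exports.
Set Implicit Arguments. Unset Strict Implicit. Unset Printing Implicit Defensive.
Local Open Scope ring_scope.
Local Open Scope classical_set_scope.

(* Let Q be the set of the (x, y) with x in J and f x <= y <= mu x. Up to the
   origin, P(f, J) is the cone over Q truncated at height 1: Q is closed and
   bounded, so taking the closure only adds the apex. By Fubini and homogeneity
   the cone over a set of R^n has volume 1/(n+1) times that of the set, hence
   vol P = (1/(d+2)) (\int_J mu - \int_J f).
   The integral of mu is a combination of the integrals of the barycentric
   coordinates, and the region below such a coordinate is a simplex of R^(d+1)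
   whose determinant is that of J up to sign. The volume of a simplex comes from
   the same cone formula: the vertex matrix maps the standard simplex of R^(n+1)
   onto the cone over the simplex of R^n. *)

(** * Lebesgue measure on tuples *)

Section Boxes.
Variable R : realType.

(** Lebesgue measure is given only through its values on boxes. Boxes are stable under intersection
    and generate the Borel sets, so a measure with these values is unique. Fubini and the linear
    change of variables both come from this uniqueness: a product measure, or a rescaled image
    measure, only has to be checked on boxes. The dimension d+1 of Q, for which no measure is given,
    gets one by iterating products. The closure adds a single point because the slice of the cone at
    height z is zQ: a bounded Q makes these slices shrink to the origin as z tends to 0, while at
    positive height dividing by z is stable and closedness of Q applies. Q is bounded above through
    mu; the lower bound on f is drawn from convexity, so that no compactness argument is needed. A
    nonzero determinant makes the barycentric coordinates affine functions of the point and the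
    simplex a finite intersection of half-spaces. Its measurability, its closedness, its volume and
    the integral of mu are all read off from these coordinates. *)

Definition tbox (n : nat) (a b : n.-tuple R) : set (n.-tuple R) :=
  [set x | forall i, tnth a i <= tnth x i <= tnth b i].

Lemma measurable_forall_ord d (T : measurableType d) (n : nat)
    (P : 'I_n -> set T) :
  (forall i, measurable (P i)) -> measurable [set x | forall i, P i x].
Proof.
move=> mP; rewrite (_ : [set x | _] = \bigcap_(i in [set: 'I_n]) P i).
  by apply: fin_bigcap_measurable => //; exact: finite_finset.
by apply/seteqP; split => x /= h i //; apply: h.
Qed.

Lemma measurable_tbox (n : nat) (a b : n.-tuple R) : measurable (tbox a b).
Proof.
apply: measurable_forall_ord => i.
have := @measurable_tnth _ R n i measurableT `[tnth a i, tnth b i]%classic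
  (measurable_itv _).
by rewrite setTI; congr measurable; apply/seteqP; split => x /=; rewrite in_itv.
Qed.

Definition cube (n : nat) (k : nat) : set (n.-tuple R) :=
  tbox [tuple - k%:R | _ < n] [tuple k%:R | _ < n].

Lemma bigcup_cube (n : nat) : \bigcup_k @cube n k = [set: n.-tuple R].
Proof.
apply/seteqP; split => // x _.
have hk i : exists k : nat, `|tnth x i| <= k%:R.
  exists (Num.truncn `|tnth x i|).+1; exact/ltW/truncnS_gt.
have [g hg] := choice hk.
exists (\max_(i < n) g i) => // i; rewrite !tnth_mktuple.
have : `|tnth x i| <= (\max_(i < n) g i)%:R.
  by apply: le_trans (hg i) _; rewrite ler_nat; exact: leq_bigmax.
by rewrite ler_norml.
Qed.

(** The product sigma-algebra is generated by preimages of Borel sets under the coordinates, and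
    Borel sets of the line by closed rays; the preimage of a ray is a countable union of boxes. *)
Lemma measurable_tuple_tbox (n : nat) :
  @measurable _ (n.-tuple R) =
  <<s [set A | exists a b : n.-tuple R, A = tbox a b] >>.
Proof.
set G := [set A | _].
apply/seteqP; split; last first.
  apply: smallest_sub; first exact: sigma_algebra_measurable.
  by move=> _ [a [b ->]]; exact: measurable_tbox.
apply: smallest_sub; first exact: smallest_sigma_algebra.
move=> A; rewrite -bigcup_seq /= => -[i _ [B mB <-{A}]]; rewrite setTI.
have sG := smallest_sigma_algebra setT G.
suff sub : <<s @RGenCInfty.G R >> `<=`
    [set B | <<s G >> ((fun x : n.-tuple R => tnth x i) @^-1` B)].
  apply: sub.
  exact: (eq_ind _ (fun S : set (set R) => S B) mB _ (RGenCInfty.measurableE R)).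
apply: smallest_sub.
  split => /=.
  - by rewrite preimage_set0; case: sG.
  - move=> C mC; rewrite setTD preimage_setC.
    by case: sG => _ /(_ _ mC); rewrite setTD.
  - by move=> F mF; rewrite preimage_bigcup; case: sG => _ _; apply.
move=> _ [a ->] /=.
(* Side [i] runs from [a] to [k] and the others from [-k] to [k]; for [k < a] the box is empty,
   which does no harm. *)
rewrite (_ : _ @^-1` _ = \bigcup_k tbox
    [tuple if j == i then a else - k%:R | j < n] [tuple k%:R | _ < n]).
  case: sG => _ _; apply => k; apply: sub_sigma_algebra.
  by eexists; eexists; reflexivity.
apply/seteqP; split => x /=; rewrite in_itv /= andbT.
  move=> ax; have := @bigcup_cube n => /seteqP[_ /(_ x I)] [k _ xk].
  exists k => // j; have := xk j; rewrite !tnth_mktuple.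
  by case: eqVneq => [->|//]; rewrite {}ax => /andP[].
by move=> [k _ /(_ i)]; rewrite !tnth_mktuple eqxx => /andP[].
Qed.

Lemma tbox_eq0 (n : nat) (a b : n.-tuple R) (i : 'I_n) :
  tnth b i < tnth a i -> tbox a b = set0.
Proof.
move=> ba; rewrite -subset0 => x /= /(_ i) /andP[h1 h2].
by have := le_lt_trans (le_trans h1 h2) ba; rewrite ltxx.
Qed.

(** Boxes form a pi-system and the cubes exhaust the space with finite measure. An intersection of
    boxes may have reversed bounds; [is_lebesgue] says nothing of these, but such a box is empty. *)
Lemma lebesgue_tuple_unique (n : nat)
    (m m' : {measure set (n.-tuple R) -> \bar R}) :
  is_lebesgue m -> is_lebesgue m' -> forall A, measurable A -> m A = m' A.
Proof.
move=> lm lm' A mA.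
pose G := [set A | exists a b : n.-tuple R, A = tbox a b].
apply: (measure_unique G (@cube n)) => //.
- exact: measurable_tuple_tbox.
- move=> _ _ [a [b ->]] [a' [b' ->]].
  exists [tuple Num.max (tnth a i) (tnth a' i) | i < n].
  exists [tuple Num.min (tnth b i) (tnth b' i) | i < n].
  apply/seteqP; split => x /=.
    move=> [h h'] i; rewrite !tnth_mktuple ge_max le_min.
    by have /andP[-> ->] := h i; have /andP[-> ->] := h' i.
  move=> h; split => i; have := h i; rewrite !tnth_mktuple ge_max le_min;
    by move=> /andP[/andP[? ?] /andP[? ?]]; apply/andP.
- by move=> k; eexists; eexists; reflexivity.
- exact: bigcup_cube.
- move=> _ [a [b ->]].
  have [h|] := pselect (forall i, tnth a i <= tnth b i); first by rewrite lm ?lm'.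
  move=> /existsNP[i /negP]; rewrite -ltNge => /tbox_eq0 ->.
  by rewrite !measure0.
- move=> k; rewrite lm ?ltry// => i; rewrite !tnth_mktuple.
  by rewrite (le_trans _ (ler0n _ _))// oppr_le0.
Qed.

Lemma lebesgue_tuple_sigma_finite (n : nat)
    (m : {measure set (n.-tuple R) -> \bar R}) :
  is_lebesgue m -> sigma_finite setT m.
Proof.
move=> lm; exists (@cube n); first by rewrite bigcup_cube.
move=> k; split; first exact: measurable_tbox.
rewrite lm ?ltry// => i; rewrite !tnth_mktuple.
by rewrite (le_trans _ (ler0n _ _))// oppr_le0.
Qed.

Lemma set1_tbox (n : nat) (x : n.-tuple R) : [set x] = tbox x x.
Proof.
apply/seteqP; split => [y /= -> i|y /= h]; first by rewrite lexx.
by apply: eq_from_tnth => i; apply/le_anti; rewrite andbC h.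
Qed.

Lemma lebesgue_tuple_point (n : nat)
    (m : {measure set (n.+1.-tuple R) -> \bar R}) x :
  is_lebesgue m -> m [set x] = 0%E.
Proof.
by move=> lm; rewrite set1_tbox lm// big_ord_recl subrr mul0r.
Qed.

End Boxes.

Section SigmaFinite.
Variables (R : realType) (n : nat) (m : {measure set (n.-tuple R) -> \bar R}).
Hypothesis lm : is_lebesgue m.

(** A copy of [m] indexed by the proof that it is Lebesgue, so that a sigma-finite structure can be
    attached to it, as the product measure requires. *)
Definition sigma_finite_of_lebesgue (_ : is_lebesgue m) : set (n.-tuple R) -> \bar R := m.

HB.instance Definition _ := Measure.on (sigma_finite_of_lebesgue lm).
HB.instance Definition _ := Measure_isSigmaFinite.Build _ _ _
  (sigma_finite_of_lebesgue lm)
  (lebesgue_tuple_sigma_finite lm).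

End SigmaFinite.

(** * Fubini *)

Section ImageMeasure.
Context d d' (T1 : measurableType d) (T2 : measurableType d') (R : realType).
Variables (m : {measure set T1 -> \bar R}) (f : T1 -> T2).
Hypothesis mf : measurable_fun [set: T1] f.

Definition image_measure (_ : measurable_fun [set: T1] f) : set T2 -> \bar R :=
  pushforward m f.

Let image_measure0 : image_measure mf set0 = 0%E.
Proof. exact: measure0. Qed.

Let image_measure_ge0 A : (0 <= image_measure mf A)%E.
Proof. exact: measure_ge0. Qed.

Let image_measure_sigma_additive : semi_sigma_additive (image_measure mf).
Proof. exact: measure_semi_sigma_additive. Qed.

HB.instance Definition _ := isMeasure.Build _ _ _ (image_measure mf)
  image_measure0 image_measure_ge0 image_measure_sigma_additive.

End ImageMeasure.

Section Insertion.
Variable R : realType.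

Definition ins (n : nat) (i : 'I_n.+1) (t : R) (y : n.-tuple R) : n.+1.-tuple R :=
  [tuple oapp (tnth y) t (unlift i k) | k < n.+1].

Lemma tnth_ins (n : nat) (i : 'I_n.+1) t (y : n.-tuple R) :
  tnth (ins i t y) i = t.
Proof. by rewrite tnth_mktuple unlift_none. Qed.

Lemma tnth_ins_lift (n : nat) (i : 'I_n.+1) t (y : n.-tuple R) j :
  tnth (ins i t y) (lift i j) = tnth y j.
Proof. by rewrite tnth_mktuple liftK. Qed.

Lemma forall_ord_lift (n : nat) (i : 'I_n.+1) (P : 'I_n.+1 -> Prop) :
  (forall k, P k) <-> P i /\ forall j, P (lift i j).
Proof.
split => [h|[h0 h] k]; first by split.
by case: (unliftP i k) => [j ->|->].
Qed.

Lemma measurable_ins (n : nat) (i : 'I_n.+1) :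
  measurable_fun setT
    (fun p : measurableTypeR R * n.-tuple R => ins i p.1 p.2).
Proof.
apply/measurable_fun_tnthP => k.
case: (unliftP i k) => [j ->|->].
  rewrite (_ : _ \o _ = (fun x => tnth x j) \o snd).
    by apply: measurableT_comp => //; exact: measurable_tnth.
  by apply/funext => p /=; rewrite tnth_ins_lift.
rewrite (_ : _ \o _ = fst); first exact: measurable_fst.
by apply/funext => p /=; rewrite tnth_ins.
Qed.

Section Product.
Variables (n : nat) (m : {measure set (n.-tuple R) -> \bar R}).
Hypothesis lm : is_lebesgue m.

Lemma preimage_ins_tbox (i : 'I_n.+1) (a b : n.+1.-tuple R) :
  (fun p : measurableTypeR R * n.-tuple R => ins i p.1 p.2) @^-1` tbox a b =
  `[tnth a i, tnth b i]%classic `*`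
  tbox [tuple tnth a (lift i j) | j < n] [tuple tnth b (lift i j) | j < n].
Proof.
apply/seteqP; split => -[t y] /=.
  move=> h; split => /=; first by have := h i; rewrite tnth_ins in_itv.
  by move=> j; have := h (lift i j); rewrite tnth_ins_lift !tnth_mktuple.
rewrite in_itv /= => -[ht hy]; apply/(forall_ord_lift i); rewrite tnth_ins.
by split => // j; have := hy j; rewrite tnth_ins_lift !tnth_mktuple.
Qed.

(** Stated for any measure with the product formula, because it is applied to both iterated
    constructions: [product_measure1] integrates the measures of slices, [product_measure2] the
    lengths of lines. By uniqueness each computes [m1], which gives the two forms of Fubini
    below. *)
Lemma is_lebesgue_image_ins (i : 'I_n.+1)
    (mu : {measure set (measurableTypeR R * n.-tuple R) -> \bar R}) :
  (forall A B, measurable A -> measurable B ->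
    mu (A `*` B) = (lebesgue_measure A * m B)%E) ->
  is_lebesgue (image_measure mu (measurable_ins i)).
Proof.
move=> muE a b ab /=.
rewrite /image_measure /pushforward -[X in mu (_ @^-1` X)]/(tbox a b).
rewrite preimage_ins_tbox muE; [|exact: measurable_itv|exact: measurable_tbox].
rewrite lm; last by move=> j; rewrite !tnth_mktuple.
rewrite lebesgue_measure_itv /= lte_fin (bigD1_ord i) //= EFinM.
congr (_ * _)%E; last by congr EFin; apply: eq_bigr => j _; rewrite !tnth_mktuple.
have := ab i; rewrite le_eqVlt => /orP[/eqP ->|->//].
by rewrite ltxx subrr.
Qed.

Variable m1 : {measure set (n.+1.-tuple R) -> \bar R}.
Hypothesis lm1 : is_lebesgue m1.

Lemma lebesgue_tuple_fubini1 (i : 'I_n.+1) A : measurable A ->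
  m1 A = (\int[lebesgue_measure]_t m [set y | A (ins i t y)])%E.
Proof.
move=> mA.
rewrite (lebesgue_tuple_unique lm1 (is_lebesgue_image_ins i
  (@product_measure1E _ _ _ _ R lebesgue_measure (sigma_finite_of_lebesgue lm))) mA).
rewrite /image_measure /pushforward /product_measure1; apply: eq_integral => t _.
congr (m _); apply/seteqP; split => y /=; first by rewrite /xsection /= inE.
by move=> h; rewrite /xsection /= inE.
Qed.

Lemma lebesgue_tuple_fubini2 (i : 'I_n.+1) A : measurable A ->
  m1 A = (\int[m]_y lebesgue_measure [set t : measurableTypeR R | A (ins i t y)])%E.
Proof.
move=> mA.
rewrite (lebesgue_tuple_unique lm1 (is_lebesgue_image_ins i
  (@product_measure2E _ _ _ _ R lebesgue_measure m)) mA).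
rewrite /image_measure /pushforward /product_measure2; apply: eq_integral => t _.
congr (lebesgue_measure _); apply/seteqP; split => y /=.
  by rewrite /ysection /= inE.
by move=> h; rewrite /ysection /= inE.
Qed.

End Product.

(** Supplies the intermediate dimensions used by inductions and by cones. In dimension 0 the space
    is one point and the empty product is 1, hence the Dirac mass. *)
Lemma exists_lebesgue_tuple (n : nat) :
  exists m : {measure set (n.-tuple R) -> \bar R}, is_lebesgue m.
Proof.
elim: n => [|n [m lm]].
  exists (@dirac _ _ [tuple] R) => a b _; rewrite big_ord0 /= diracE.
  by rewrite mem_set//= => -[].
eexists.
exact: (is_lebesgue_image_ins lm ord0
  (@product_measure2E _ _ _ _ R lebesgue_measure m)).
Qed.

End Insertion.

(** * Linear change of variables *)

Section LinearMaps.
Variable R : realType.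

Definition mact (n : nat) (T : 'M[R]_n) (x : n.-tuple R) : n.-tuple R :=
  [tuple \sum_(j < n) T i j * tnth x j | i < n].

Lemma measurable_tuple_lin (n : nat) (c : 'I_n -> R) (b : R) :
  measurable_fun setT (fun x : n.-tuple R => \sum_(j < n) c j * tnth x j + b).
Proof.
apply: measurable_funD => //; apply: measurable_sum => j.
by apply: measurable_funM => //; exact: measurable_tnth.
Qed.

Lemma measurable_mact (n : nat) (T : 'M[R]_n) : measurable_fun setT (mact T).
Proof.
apply/measurable_fun_tnthP => i.
rewrite (_ : _ \o _ = fun x : n.-tuple R => \sum_(j < n) T i j * tnth x j + 0).
  exact: measurable_tuple_lin.
by apply/funext => x /=; rewrite tnth_mktuple addr0.
Qed.

Lemma mact_mul (n : nat) (S T : 'M[R]_n) x : mact (S *m T) x = mact S (mact T x).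
Proof.
apply: eq_from_tnth => i; rewrite !tnth_mktuple.
under eq_bigr do rewrite mxE mulr_suml.
rewrite exchange_big /=; apply: eq_bigr => k _.
by rewrite tnth_mktuple mulr_sumr; apply: eq_bigr => j _; rewrite mulrA.
Qed.

Lemma mact1 (n : nat) (x : n.-tuple R) : mact 1%:M x = x.
Proof.
apply: eq_from_tnth => i; rewrite tnth_mktuple (bigD1 i) //= big1.
  by rewrite mxE eqxx mul1r addr0.
by move=> j ji; rewrite mxE eq_sym (negPf ji) mul0r.
Qed.

Lemma mactK (n : nat) (T : 'M[R]_n) : T \in unitmx ->
  cancel (mact T) (mact (invmx T)).
Proof. by move=> uT x; rewrite -mact_mul mulVmx// mact1. Qed.

Lemma mactVK (n : nat) (T : 'M[R]_n) : T \in unitmx ->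
  cancel (mact (invmx T)) (mact T).
Proof. by move=> uT x; rewrite -mact_mul mulmxV// mact1. Qed.

(** The preimage form keeps sets measurable without inverting [T]. *)
Definition scales_volume (n : nat) (m : set (n.-tuple R) -> \bar R) (T : 'M[R]_n) :=
  forall A, measurable A -> (`|\det T|%:E * m (mact T @^-1` A) = m A)%E.

(** The image of [m] under [T], multiplied by [|det T|], is then right on boxes, so it is [m] by
    uniqueness. *)
Lemma scales_volume_tbox (n : nat) (m : {measure set (n.-tuple R) -> \bar R}) T :
  is_lebesgue m ->
  (forall a b : n.-tuple R, (forall i, tnth a i <= tnth b i) ->
    (`|\det T|%:E * m (mact T @^-1` tbox a b) =
     (\prod_(i < n) (tnth b i - tnth a i))%:E)%E) ->
  scales_volume m T.
Proof.
move=> lm h A mA.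
pose m' := mscale (NngNum (normr_ge0 (\det T))) (image_measure m (measurable_mact T)).
have lm' : is_lebesgue m' by move=> a b ab; rewrite -h.
by rewrite -(lebesgue_tuple_unique lm' lm mA).
Qed.

(** The elementary matrix of the elimination: it scales the [i]-th coordinate and shears it along
    all others at once. *)
Definition row_replace (n : nat) (i : 'I_n) (r : 'rV[R]_n) : 'M[R]_n :=
  \matrix_(k, j) (if k == i then r 0 j else (k == j)%:R).

(** Cofactors along row [i] do not see row [i], so they are those of the identity, whose adjugate is
    the identity. *)
Lemma det_row_replace (n : nat) (i : 'I_n) (r : 'rV[R]_n) :
  \det (row_replace i r) = r 0 i.
Proof.
have adj1 : \adj (1%:M : 'M[R]_n) = 1%:M.
  by rewrite -[LHS]mul1mx mul_mx_adj det1.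
rewrite (expand_det_row _ i).
have cof j : cofactor (row_replace i r) i j = (i == j)%:R.
  have <- : cofactor (1%:M : 'M[R]_n) i j = (i == j)%:R.
    by have := congr1 (fun M : 'M[R]_n => M j i) adj1; rewrite !mxE eq_sym.
  rewrite /cofactor; congr (_ * \det _); apply/matrixP => k l.
  by rewrite !mxE eq_sym (negPf (neq_lift _ _)).
rewrite (bigD1 i) //= big1 => [|j ji].
  by rewrite addr0 cof eqxx mulr1 mxE eqxx.
by rewrite cof eq_sym (negPf ji) mulr0.
Qed.

Lemma row_row_replace_mul (n : nat) (i : 'I_n) (r : 'rV[R]_n) (T : 'M[R]_n) k :
  row k (row_replace i r *m T) = if k == i then r *m T else row k T.
Proof.
apply/rowP => j; rewrite !mxE; case: ifP => [/eqP ->|ki].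
  by rewrite mxE; apply: eq_bigr => l _; rewrite !mxE eqxx.
rewrite mxE (bigD1 k) //= big1 => [|l lk].
  by rewrite mxE ki eqxx mul1r addr0.
by rewrite mxE ki eq_sym (negPf lk) mul0r.
Qed.

Lemma lebesgue_affine_preimage (r s a b : R) : r != 0 -> a <= b ->
  lebesgue_measure [set t : measurableTypeR R | a <= r * t + s <= b] =
  ((b - a) / `|r|)%:E.
Proof.
move=> r0 ab.
have itvE x y : x <= y ->
    lebesgue_measure (`[x, y]%classic : set (measurableTypeR R)) = (y - x)%:E.
  move=> xy; rewrite lebesgue_measure_itv /= lte_fin.
  by move: xy; rewrite le_eqVlt => /orP[/eqP ->|->//]; rewrite ltxx subrr.
have [rp|rn|] := ltgtP r 0; last by move/eqP; rewrite (negPf r0).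
- rewrite (_ : [set _ | _] = `[(b - s) / r, (a - s) / r]%classic).
    rewrite itvE.
      by rewrite -mulrBl ltr0_norm// invrN mulrN -mulNr; congr (_ * _)%:E; ring.
    by rewrite ler_nM2r ?invr_lt0// lerD2r.
  apply/seteqP; split => t /=; rewrite in_itv /= ler_ndivrMr// ler_ndivlMr//;
    by rewrite mulrC lerBlDr lerBrDr andbC.
- rewrite (_ : [set _ | _] = `[(a - s) / r, (b - s) / r]%classic).
    rewrite itvE; first by rewrite -mulrBl gtr0_norm// opprB addrA subrK.
    by rewrite ler_pM2r ?invr_gt0// lerD2r.
  apply/seteqP; split => t /=; rewrite in_itv /= ler_pdivrMr// ler_pdivlMr//;
    by rewrite mulrC lerBlDr lerBrDr.
Qed.

Lemma tnth_mact_row_replace (n : nat) (i : 'I_n.+1) r t (y : n.-tuple R) :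
  tnth (mact (row_replace i r) (ins i t y)) i =
  r 0 i * t + \sum_(j < n) r 0 (lift i j) * tnth y j.
Proof.
rewrite tnth_mktuple (bigD1_ord i) //= mxE eqxx tnth_ins; congr (_ + _).
by apply: eq_bigr => j _; rewrite mxE eqxx tnth_ins_lift.
Qed.

Lemma tnth_mact_row_replace_lift (n : nat) (i : 'I_n.+1) r t (y : n.-tuple R) j :
  tnth (mact (row_replace i r) (ins i t y)) (lift i j) = tnth y j.
Proof.
rewrite tnth_mktuple (bigD1 (lift i j)) //= big1 => [|k kj].
  by rewrite mxE eq_sym (negPf (neq_lift _ _)) eqxx mul1r tnth_ins_lift addr0.
by rewrite mxE eq_sym (negPf (neq_lift _ _)) eq_sym (negPf kj) mul0r.
Qed.

(** The map fixes all coordinates but the [i]-th, and on each line in direction [i] it is affine of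
    slope [r 0 i]. The shift varies with the line but does not affect lengths, so integrating along
    coordinate [i] first gives the factor. *)
Lemma scales_volume_row_replace (n : nat)
    (m : {measure set (n.+1.-tuple R) -> \bar R}) (i : 'I_n.+1) (r : 'rV[R]_n.+1) :
  is_lebesgue m -> r 0 i != 0 -> scales_volume m (row_replace i r).
Proof.
move=> lm r0; have [m' lm'] := exists_lebesgue_tuple R n.
apply: scales_volume_tbox => // a b ab; rewrite det_row_replace.
pose a' := [tuple tnth a (lift i j) | j < n].
pose b' := [tuple tnth b (lift i j) | j < n].
have a'b' j : tnth a' j <= tnth b' j by rewrite !tnth_mktuple.
rewrite (lebesgue_tuple_fubini2 lm' lm i); last first.
  rewrite -[X in measurable X]setTI; apply: measurable_mact => //.
  exact: measurable_tbox.
pose c := ((tnth b i - tnth a i) / `|r 0 i|)%:E.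
transitivity (`|r 0 i|%:E * \int[m']_(y in tbox a' b') (cst c) y)%E.
  congr (_ * _)%E; rewrite [RHS]integral_mkcond; apply: eq_integral => y _.
  rewrite patchE; case: ifPn => [|]; rewrite ?notin_setE ?inE => hy.
    rewrite /cst /c.
    rewrite -(lebesgue_affine_preimage (\sum_j r 0 (lift i j) * tnth y j) r0 (ab i)).
    congr lebesgue_measure; apply/seteqP; split => t /=.
      by move=> /(_ i); rewrite tnth_mact_row_replace.
    move=> h; apply/(forall_ord_lift i); rewrite tnth_mact_row_replace; split=> // j.
    by rewrite tnth_mact_row_replace_lift; have := hy j; rewrite !tnth_mktuple.
  rewrite (_ : [set _ | _] = set0) ?measure0// -subset0 => t /= h; apply: hy => j.
  by rewrite !tnth_mktuple -(tnth_mact_row_replace_lift i r t y j).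
rewrite integral_cst; last exact: measurable_tbox.
rewrite lm'// -!EFinM (bigD1_ord i) //=; congr EFin.
rewrite mulrA mulrCA divff ?normr_eq0// mulr1; congr (_ * _).
by apply: eq_bigr => j _; rewrite !tnth_mktuple.
Qed.

Lemma scales_volume_perm (n : nat) (m : {measure set (n.-tuple R) -> \bar R})
    (s : 'S_n) : is_lebesgue m -> scales_volume m (perm_mx s).
Proof.
move=> lm; apply: scales_volume_tbox => // a b ab.
rewrite det_perm normrX normrN1 expr1n mul1e.
have actE x k : tnth (mact (perm_mx s) x) k = tnth x (s k).
  rewrite tnth_mktuple (bigD1 (s k)) //= big1 => [|j js].
    by rewrite !mxE eqxx mul1r addr0.
  by rewrite !mxE eq_sym (negPf js) mul0r.
rewrite (_ : _ @^-1` _ = tbox [tuple tnth a (s^-1 k)%g | k < n]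
    [tuple tnth b (s^-1 k)%g | k < n]).
  rewrite lm => [|k]; last by rewrite !tnth_mktuple.
  rewrite (reindex_inj (@perm_inj _ s)) /=; congr EFin.
  by apply: eq_bigr => k _; rewrite !tnth_mktuple permK.
apply/seteqP; split => x /= h k.
  by have := h (s^-1 k)%g; rewrite actE permKV !tnth_mktuple.
by have := h (s k); rewrite actE !tnth_mktuple permK.
Qed.

(** Lets the elimination strip factors on the left of [T]. Both hypotheses are applied to [B], the
    image of [A] under [S], and [|det S|] cancels. *)
Lemma scales_volume_cancel (n : nat) (m : {measure set (n.-tuple R) -> \bar R})
    (S T : 'M[R]_n) : S \in unitmx ->
  scales_volume m S -> scales_volume m (S *m T) -> scales_volume m T.
Proof.
move=> uS hS hST A mA.
pose B := mact (invmx S) @^-1` A.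
have mB : measurable B.
  by rewrite -[B]setTI; apply: measurable_mact.
have SB : mact S @^-1` B = A.
  by apply/seteqP; split => x /=; rewrite /B /= mactK.
have STB : mact (S *m T) @^-1` B = mact T @^-1` A.
  by rewrite -SB; apply/seteqP; split => x /=; rewrite mact_mul.
have dS : `|\det S| != 0 by rewrite normr_eq0 -unitfE -unitmxE.
have := hST _ mB; rewrite STB -(hS _ mB) SB det_mulmx normrM EFinM -muleA.
move/(congr1 (fun z => (`|\det S|^-1)%:E * z)%E).
by rewrite !muleA -!EFinM mulVf// !mul1r mul1e.
Qed.

(* Gaussian elimination, by induction on a bound [k] beyond which the rows are
   those of the identity: the [k]-th row of the identity is a combination of the
   rows of [T] involving some row [i <= k], which it may therefore replace. *)
Lemma scales_volume_unitmx (n : nat) (m : {measure set (n.-tuple R) -> \bar R})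
    (T : 'M[R]_n) : is_lebesgue m -> T \in unitmx -> scales_volume m T.
Proof.
case: n m T => [|n] m T lm.
  move=> _ A mA; rewrite det_mx00 normr1 mul1e; congr (m _).
  have mactE x : mact T x = x by rewrite [x]tuple0 [mact _ _]tuple0.
  by apply/seteqP; split => x /=; rewrite mactE.
suff h k (T' : 'M[R]_n.+1) : T' \in unitmx ->
    (forall i : 'I_n.+1, (k <= i)%N -> row i T' = row i 1%:M) -> scales_volume m T'.
  by move=> uT; apply: (h n.+1) => // i; rewrite leqNgt ltn_ord.
elim: k => [|k IHk] in T' * => uT hT.
  have -> : T' = 1%:M by apply/row_matrixP => i; rewrite hT.
  move=> A mA; rewrite det1 normr1 mul1e; congr (m _).
  by apply/seteqP; split => x /=; rewrite mact1.
have [kn|nk] := ltnP k n.+1; last first.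
  apply: IHk => // i ki; apply: hT.
  by have := leq_trans (ltn_ord i) (leq_trans nk ki); rewrite ltnn.
pose ik := Ordinal kn.
pose c := row ik (invmx T').
have cT : c *m T' = row ik 1%:M by rewrite -row_mul mulVmx.
have [i ik_le ci] : exists2 i : 'I_n.+1, (i <= k)%N & c 0 i != 0.
  (* Otherwise entry [ik] of [c *m T'], which is 1, would be a sum of zeros: the rows beyond [k] are
     those of the identity and vanish in column [ik]. *)
  apply: contrapT => hn.
  have := congr1 (fun M : 'rV[R]__ => M 0 ik) cT; rewrite !mxE eqxx big1.
    by move/esym/eqP; rewrite oner_eq0.
  move=> i _; have [ik_le|ki] := leqP i k.
    have [->|ci] := eqVneq (c 0 i) 0; first by rewrite mul0r.
    by exfalso; apply: hn; exists i.
  have := congr1 (fun M : 'rV[R]__ => M 0 ik) (hT i ki); rewrite !mxE => ->.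
  by case: eqVneq => [e|_]; [move: ki; rewrite e /= ltnn|rewrite mulr0].
have uE : row_replace i c \in unitmx by rewrite unitmxE det_row_replace unitfE.
apply: (scales_volume_cancel uE); first exact: scales_volume_row_replace.
(* Row [i] of the product is now row [ik] of the identity; the swap moves it to place [k]. Rows
   beyond [k] are untouched since [i <= k]. *)
have uP : perm_mx (tperm i ik) \in @unitmx R n.+1 by exact: unitmx_perm.
apply: (scales_volume_cancel uP); first exact: scales_volume_perm.
apply: IHk => [|l kl]; first by rewrite !unitmx_mul uP uE.
rewrite -row_permE; apply/rowP => j.
have -> : row l (row_perm (tperm i ik) (row_replace i c *m T')) =
    row (tperm i ik l) (row_replace i c *m T') by apply/rowP => j'; rewrite !mxE.
rewrite row_row_replace_mul; case: tpermP => [li|->|/eqP li /eqP lk].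
- have e : ik = i by apply/val_inj/eqP; rewrite /= eqn_leq ik_le andbT -li kl.
  by rewrite e eqxx cT e li.
- by rewrite eqxx cT.
- rewrite (negPf li) hT// ltn_neqAle kl andbT.
  by apply: contra lk => /eqP e; apply/eqP/val_inj.
Qed.

End LinearMaps.

(** * Volume of cones *)

Section Cones.
Variable R : realType.

(** The last coordinate is the height. The apex is left out, so that the division by the height is
    genuine; it is added back as [tzero] where needed. *)
Definition cone (n : nat) (B : set (n.-tuple R)) : set (n.+1.-tuple R) :=
  [set p | 0 < tnth p ord_max <= 1 /\
    B [tuple (tnth p ord_max)^-1 * tnth p (lift ord_max i) | i < n]].

Lemma ins_maxE (n : nat) (p : n.+1.-tuple R) :
  p = ins ord_max (tnth p ord_max) [tuple tnth p (lift ord_max i) | i < n].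
Proof.
apply: eq_from_tnth; apply/(forall_ord_lift ord_max); rewrite tnth_ins.
by split => // j; rewrite tnth_ins_lift tnth_mktuple.
Qed.

Lemma cone_ins (n : nat) (B : set (n.-tuple R)) z w :
  cone B (ins ord_max z w) <-> 0 < z <= 1 /\ B (tscale z^-1 w).
Proof.
rewrite /cone /= tnth_ins (_ : [tuple _ | _ < _] = tscale z^-1 w)//.
by apply: eq_from_tnth => i; rewrite tnth_mktuple tnth_ins_lift tnth_mktuple.
Qed.

Lemma measurable_cone (n : nat) (B : set (n.-tuple R)) :
  measurable B -> measurable (cone B).
Proof.
move=> mB.
(* Inversion is continuous only away from 0; [g] agrees with it at positive heights and is
   measurable everywhere. *)
pose g (z : R) : R := if 0 < z then z^-1 else 0.
have mg : measurable_fun setT g.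
  apply: measurable_fun_if => //; first exact: measurable_fun_ltr.
  rewrite setTI (_ : _ @^-1` _ = `]0, +oo[%classic); last first.
    by apply/seteqP; split => z /=; rewrite in_itv /= andbT.
  apply: open_continuous_measurable_fun; first exact: interval_open.
  move=> z; rewrite inE /= in_itv /= andbT => z0.
  by apply: inv_continuous; rewrite gt_eqF.
pose h := fun p : n.+1.-tuple R =>
  [tuple g (tnth p ord_max) * tnth p (lift ord_max i) | i < n].
have mh : measurable_fun setT h.
  apply/measurable_fun_tnthP => i.
  rewrite (_ : _ \o _ = fun p : n.+1.-tuple R =>
    g (tnth p ord_max) * tnth p (lift ord_max i)).
    apply: measurable_funM; last exact: measurable_tnth.
    by apply: (measurableT_comp mg); exact: measurable_tnth.
  by apply/funext => p /=; rewrite tnth_mktuple.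
rewrite (_ : cone B = ((fun p => tnth p ord_max) @^-1` `]0, 1]%classic) `&` (h @^-1` B)).
  apply: measurableI.
    by rewrite -[X in measurable X]setTI; exact: measurable_tnth.
  by rewrite -[X in measurable X]setTI; exact: mh.
have hE (p : n.+1.-tuple R) : 0 < tnth p ord_max ->
    h p = [tuple (tnth p ord_max)^-1 * tnth p (lift ord_max i) | i < n].
  move=> p0; apply: eq_from_tnth => i; rewrite !tnth_mktuple /g.
  by rewrite p0.
apply/seteqP; split => p; rewrite /cone /= in_itv /=.
  by move=> [p01 Bp]; split => //; rewrite hE//; case/andP: p01.
by move=> [p01]; rewrite hE//; case/andP: p01.
Qed.

Lemma integral_exprn01 (n : nat) :
  (\int[lebesgue_measure]_(t in `]0%R, 1%R]) (t ^+ n)%:E = (n.+1%:R^-1 : R)%:E)%E.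
Proof.
rewrite integral_itv_obnd_cbnd; last first.
  by apply/measurable_EFinP; apply: measurable_funTS; exact: exprn_measurable.
rewrite (@continuous_FTC2 _ _ (fun x : R => x ^+ n.+1 * n.+1%:R^-1))//=.
- by rewrite expr1n expr0n /= mul0r mul1r sube0.
- by apply: continuous_in_subspaceT => x _; exact: exprn_continuous.
- split.
  + by move=> y y01; apply: derivableM => //=; exact: exprn_derivable.
  + apply: cvg_at_right_filter; apply: cvgM; last exact: cvg_cst.
    exact: exprn_continuous.
  + apply: cvg_at_left_filter; apply: cvgM; last exact: cvg_cst.
    exact: exprn_continuous.
- move=> x x01; rewrite derive1Mr//; last exact: exprn_derivable.
  by rewrite derive1E exp_derive scaler1 mulrAC -mulr_natl mulfV// mul1r.
Qed.

Lemma mact_scalar (n : nat) (a : R) (x : n.-tuple R) : mact a%:M x = tscale a x.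
Proof.
apply: eq_from_tnth => i; rewrite !tnth_mktuple (bigD1 i) //= big1.
  by rewrite mxE eqxx mulr1n addr0.
by move=> j ji; rewrite mxE eq_sym (negPf ji) mulr0n mul0r.
Qed.

(** The slice at height [t] is [B] scaled by [t], of volume [t ^+ n] times that of [B]; integrating
    over the heights in []0, 1]] produces the constant. *)
Lemma lebesgue_cone (n : nat) (m : {measure set (n.-tuple R) -> \bar R})
    (m1 : {measure set (n.+1.-tuple R) -> \bar R}) B :
  is_lebesgue m -> is_lebesgue m1 -> measurable B ->
  m1 (cone B) = ((n.+1%:R^-1)%:E * m B)%E.
Proof.
move=> lm lm1 mB; rewrite (lebesgue_tuple_fubini1 lm lm1 ord_max); last first.
  exact: measurable_cone.
rewrite -integral_exprn01 -ge0_integralZr//; last 2 first.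
- by apply/measurable_EFinP; apply: measurable_funTS; exact: exprn_measurable.
- by move=> t /=; rewrite in_itv /= => /andP[t0 _]; rewrite lee_fin exprn_ge0// ltW.
rewrite [RHS]integral_mkcond; apply: eq_integral => t _; rewrite patchE.
case: ifPn; rewrite ?notin_setE ?inE /= in_itv /= => t01; last first.
  rewrite (_ : [set _ | _] = set0) ?measure0// -subset0 => w /= /cone_ins[].
  by move/t01.
have t0 : 0 < t by case/andP: t01.
rewrite (_ : [set _ | _] = mact (t^-1)%:M @^-1` B).
  have u : (t^-1)%:M \in @unitmx R n.
    by rewrite unitmxE det_scalar unitfE expf_neq0// invr_eq0 gt_eqF.
  rewrite -(scales_volume_unitmx lm u mB) det_scalar muleA -EFinM.
  rewrite ger0_norm ?exprn_ge0 ?invr_ge0 ?(ltW t0)// exprVn mulfV ?mul1e//.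
  by rewrite expf_neq0// gt_eqF.
apply/seteqP; split => w /=; rewrite mact_scalar; first by case/cone_ins.
by move=> h; apply/cone_ins.
Qed.

Lemma lebesgue_tuple_setU1 (n : nat) (m : {measure set (n.+1.-tuple R) -> \bar R})
    A x : is_lebesgue m -> measurable A -> ~ A x -> m (A `|` [set x]) = m A.
Proof.
move=> lm mA Ax; have mx : measurable [set x].
  by rewrite set1_tbox; exact: measurable_tbox.
have Ax0 : A `&` [set x] = set0.
  by rewrite -subset0 => y /= [Ay yx]; apply: Ax; rewrite -yx.
rewrite measureU//= -[RHS]adde0; congr (_ + _)%E.
exact: lebesgue_tuple_point.
Qed.

Definition tzero (n : nat) : n.-tuple R := [tuple 0 | _ < n].

Lemma cone_tzero (n : nat) (B : set (n.-tuple R)) : ~ cone B (tzero n.+1).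
Proof. by rewrite /cone /= tnth_mktuple ltxx => -[]. Qed.

Lemma lebesgue_cone0 (n : nat) (m : {measure set (n.-tuple R) -> \bar R})
    (m1 : {measure set (n.+1.-tuple R) -> \bar R}) B :
  is_lebesgue m -> is_lebesgue m1 -> measurable B ->
  m1 (cone B `|` [set tzero n.+1]) = ((n.+1%:R^-1)%:E * m B)%E.
Proof.
move=> lm lm1 mB; rewrite lebesgue_tuple_setU1//; last 2 first.
- exact: measurable_cone.
- exact: cone_tzero.
exact: lebesgue_cone.
Qed.

Definition std_simplex (n : nat) : set (n.-tuple R) :=
  [set x | (forall i, 0 <= tnth x i) /\ \sum_(i < n) tnth x i <= 1].

Lemma measurable_lin_ge0 (n : nat) (c : 'I_n -> R) (b : R) :
  measurable [set x : n.-tuple R | 0 <= \sum_(j < n) c j * tnth x j + b].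
Proof.
have := measurable_tuple_lin c b measurableT (measurable_itv `[0, +oo[%R).
rewrite setTI; congr measurable.
by apply/seteqP; split => x /=; rewrite in_itv /= andbT.
Qed.

Lemma measurable_std_simplex (n : nat) : measurable (@std_simplex n).
Proof.
apply: measurableI.
  apply: measurable_forall_ord => i.
  have := @measurable_tnth _ R n i measurableT _ (measurable_itv `[0, +oo[%R).
  rewrite setTI; congr measurable.
  by apply/seteqP; split => x /=; rewrite in_itv /= andbT.
have := @measurable_lin_ge0 n (fun=> -1) 1; congr measurable.
by apply/seteqP; split => x /=; rewrite -mulr_sumr mulN1r addrC subr_ge0.
Qed.

(** The shear that subtracts the other coordinates from the last one has determinant 1. The preimage
    of the simplex under it is given by nonnegative coordinates [w] with sum at most [z], and
    [z <= 1]: the cone over the simplex one dimension lower, with its apex. *)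
Lemma lebesgue_std_simplex (n : nat) (m : {measure set (n.-tuple R) -> \bar R}) :
  is_lebesgue m -> m (@std_simplex n) = (n`!%:R^-1)%:E.
Proof.
elim: n m => [|n IHn] m lm.
  have -> : @std_simplex 0 = tbox [tuple] [tuple].
    by apply/seteqP; split => x //= _; [case|split; [case|rewrite big_ord0]].
  by rewrite lm ?big_ord0 ?invr1// => -[].
have [m' lm'] := exists_lebesgue_tuple R n.
have := lebesgue_cone0 lm' lm (@measurable_std_simplex n).
rewrite IHn// -EFinM -invfM -natrM -factS => <-.
pose r : 'rV[R]_n.+1 := \row_j (if j == ord_max then 1 else -1).
have rm : r 0 ord_max = 1 by rewrite mxE eqxx.
have u : row_replace ord_max r \in unitmx by rewrite unitmxE det_row_replace rm unitr1.
rewrite -(scales_volume_unitmx lm u (@measurable_std_simplex n.+1)).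
rewrite det_row_replace rm normr1 mul1e; congr (m _).
have key z (w : n.-tuple R) :
    std_simplex (mact (row_replace ord_max r) (ins ord_max z w)) <->
    [/\ forall j, 0 <= tnth w j, \sum_(j < n) tnth w j <= z & z <= 1].
  have sE : \sum_(j < n) r 0 (lift ord_max j) * tnth w j = - \sum_(j < n) tnth w j.
    rewrite -sumrN; apply: eq_bigr => j _.
    by rewrite mxE eq_sym (negPf (neq_lift _ _)) mulN1r.
  rewrite /std_simplex /= (bigD1_ord ord_max) //= (forall_ord_lift ord_max).
  rewrite tnth_mact_row_replace sE rm mul1r subr_ge0.
  under eq_bigr do rewrite tnth_mact_row_replace_lift.
  rewrite subrK; split.
    move=> [[h1 h2] h3]; split=> // j.
    by rewrite -(tnth_mact_row_replace_lift ord_max r z w j).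
  by move=> [h1 h2 h3]; split=> //; split=> // j; rewrite tnth_mact_row_replace_lift.
apply/seteqP; split => p; rewrite /= [p]ins_maxE;
    move: (tnth p ord_max) [tuple _ | _ < _] => z w.
  move/key => [h1 h2 h3]; have [z0|z0] := ltP 0 z.
    left; apply/cone_ins; rewrite z0 h3; split => //; split => [i|].
      by rewrite tnth_mktuple mulr_ge0// invr_ge0 ltW.
    under eq_bigr do rewrite tnth_mktuple.
    by rewrite -mulr_sumr ler_pdivrMl// mulr1.
  (* At height [z <= 0] the nonnegative coordinates have sum at most 0, so only the apex is left. *)
  right; have s0 : \sum_(j < n) tnth w j = 0.
    by apply/le_anti; rewrite (le_trans h2 z0) sumr_ge0.
  have w0 j : tnth w j = 0.
    apply/eqP; move/eqP: s0; rewrite psumr_eq0// => /allP.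
    by move=> /(_ j (mem_index_enum _)) /implyP; apply.
  apply: eq_from_tnth; apply/(forall_ord_lift ord_max); rewrite tnth_ins tnth_mktuple.
  split; last by move=> j; rewrite tnth_ins_lift w0 tnth_mktuple.
  by apply/le_anti; rewrite z0 -s0.
case; last first.
  move=> e; apply/key.
  have w0 j : tnth w j = 0 by rewrite -(tnth_ins_lift ord_max z w j) e tnth_mktuple.
  have -> : z = 0 by rewrite -(tnth_ins ord_max z w) e tnth_mktuple.
  by split=> [j||//]; rewrite ?w0// big1.
move/cone_ins => [/andP[z0 z1] [h1 h2]]; apply/key; split => // [j|].
  by have := h1 j; rewrite tnth_mktuple pmulr_rge0// invr_gt0.
move: h2; under eq_bigr do rewrite tnth_mktuple.
by rewrite -mulr_sumr ler_pdivrMl// mulr1.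
Qed.

End Cones.

(** * Volume of simplices *)

Section Simplices.
Variable R : realType.

Section Barycentric.
Variables (n : nat) (w : 'I_n.+1 -> n.-tuple R).
Hypothesis detV : \det (vertex_matrix w) != 0.

Lemma vertex_matrix_max j : vertex_matrix w ord_max j = 1.
Proof. by rewrite mxE /= ltnn. Qed.

Lemma vertex_matrix_lift i j : vertex_matrix w (lift ord_max i) j = tnth (w j) i.
Proof. by rewrite mxE lift_max ltn_ord (tnth_nth 0). Qed.

Let V := vertex_matrix w.

Let uV : V \in unitmx. Proof. by rewrite unitmxE unitfE. Qed.

(** Solves the system whose last equation, from the row of ones of the vertex matrix, says that the
    weights sum to 1. *)
Definition bary (x : n.-tuple R) : n.+1.-tuple R :=
  mact (invmx (vertex_matrix w)) (ins ord_max 1 x).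

Lemma sum_mact_invmx p : \sum_j tnth (mact (invmx V) p) j = tnth p ord_max.
Proof.
rewrite -[in RHS](mactVK uV p) tnth_mktuple; apply: eq_bigr => j _.
by rewrite vertex_matrix_max mul1r.
Qed.

Lemma sum_bary x : \sum_j tnth (bary x) j = 1.
Proof. by rewrite sum_mact_invmx tnth_ins. Qed.

Lemma bary_comb x i : tnth x i = \sum_j tnth (bary x) j * tnth (w j) i.
Proof.
rewrite -(tnth_ins_lift ord_max 1 x i) -(mactVK uV (ins _ _ _)) tnth_mktuple.
by apply: eq_bigr => j _; rewrite vertex_matrix_lift mulrC.
Qed.

Lemma bary_unique x (lam : 'I_n.+1 -> R) : \sum_j lam j = 1 ->
  (forall i, tnth x i = \sum_j lam j * tnth (w j) i) ->
  forall j, tnth (bary x) j = lam j.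
Proof.
move=> lam1 xE j.
rewrite /bary; suff <- : mact V [tuple lam k | k < n.+1] = ins ord_max 1 x.
  by rewrite mactK// tnth_mktuple.
apply: eq_from_tnth; apply/(forall_ord_lift ord_max); split => [|i].
  rewrite tnth_ins tnth_mktuple -lam1; apply: eq_bigr => k _.
  by rewrite vertex_matrix_max mul1r tnth_mktuple.
rewrite tnth_ins_lift xE tnth_mktuple; apply: eq_bigr => k _.
by rewrite vertex_matrix_lift mulrC tnth_mktuple.
Qed.

Lemma conv_hullP x : conv_hull w x <-> forall j, 0 <= tnth (bary x) j.
Proof.
split=> [[lam [lam0 lam1 xE]] j|h]; first by rewrite (bary_unique lam1 xE).
by exists (tnth (bary x)); split => //; [exact: sum_bary|exact: bary_comb].
Qed.

Lemma tnth_bary x j : tnth (bary x) j =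
  \sum_(i < n) invmx V j (lift ord_max i) * tnth x i + invmx V j ord_max.
Proof.
rewrite tnth_mktuple (bigD1_ord ord_max) //= tnth_ins mulr1 addrC.
by congr (_ + _); apply: eq_bigr => i _; rewrite tnth_ins_lift.
Qed.

Lemma measurable_conv_hull : measurable (conv_hull w).
Proof.
rewrite (_ : conv_hull w = [set x | forall j, 0 <= tnth (bary x) j]); last first.
  by apply/seteqP; split => x /conv_hullP.
apply: measurable_forall_ord => j.
have := measurable_lin_ge0 (fun i => invmx V j (lift ord_max i)) (invmx V j ord_max).
by congr measurable; apply/seteqP; split => x /=; rewrite tnth_bary.
Qed.

Lemma mact_tscale (k : nat) (T : 'M[R]_k) z (x : k.-tuple R) :
  mact T (tscale z x) = tscale z (mact T x).
Proof. by rewrite -!mact_scalar -!mact_mul scalar_mxC. Qed.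

(** The vertex matrix sends weights to their combination of vertices with their sum as height. Sum
    at most 1 is thus height at most 1, and the weights divided by a positive height are barycentric
    coordinates. *)
Lemma cone_conv_hull :
  cone (conv_hull w) `|` [set tzero R n.+1] = mact (invmx V) @^-1` @std_simplex R n.+1.
Proof.
have V0 : mact (invmx V) (tzero R n.+1) = tzero R n.+1.
  apply: eq_from_tnth => i; rewrite !tnth_mktuple big1// => j _.
  by rewrite tnth_mktuple mulr0.
have key z x j : 0 < z -> (0 <= tnth (mact (invmx V) (ins ord_max z x)) j) =
    (0 <= tnth (bary (tscale z^-1 x)) j).
  move=> z0; have -> : ins ord_max z x = tscale z (ins ord_max 1 (tscale z^-1 x)).
    apply: eq_from_tnth; apply/(forall_ord_lift ord_max); split => [|i].
      by rewrite tnth_ins tnth_mktuple tnth_ins mulr1.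
    rewrite tnth_ins_lift tnth_mktuple tnth_ins_lift tnth_mktuple mulrA.
    by rewrite mulfV ?mul1r// gt_eqF.
  by rewrite mact_tscale tnth_mktuple pmulr_rge0.
apply/seteqP; split => p /=.
  case=> [|->]; last first.
    rewrite V0; split => [i|]; first by rewrite tnth_mktuple.
    by rewrite big1// => i _; rewrite tnth_mktuple.
  rewrite [p]ins_maxE => /cone_ins [/andP[z0 z1] /conv_hullP h].
  by split => [j|]; [rewrite key|rewrite sum_mact_invmx tnth_ins].
move=> [h1]; rewrite sum_mact_invmx => h2.
have [p0|p0] := ltP 0 (tnth p ord_max).
  left; rewrite [p]ins_maxE; apply/cone_ins; rewrite p0 h2; split => //.
  by apply/conv_hullP => j; rewrite -key// -ins_maxE.
right; rewrite -(mactVK uV p).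
have s0 : \sum_j tnth (mact (invmx V) p) j = 0.
  by apply/le_anti; rewrite {1}sum_mact_invmx p0 sumr_ge0.
suff -> : mact (invmx V) p = tzero R n.+1 by rewrite -{1}V0 mactVK.
apply: eq_from_tnth => j; rewrite [RHS]tnth_mktuple; apply/eqP.
by move/eqP: s0; rewrite psumr_eq0// => /allP/(_ j (mem_index_enum _)) /implyP; apply.
Qed.

Lemma lebesgue_conv_hull (m : {measure set (n.-tuple R) -> \bar R}) :
  is_lebesgue m -> m (conv_hull w) = (n`!%:R^-1 * `|\det (vertex_matrix w)|)%:E.
Proof.
move=> lm; have [m1 lm1] := exists_lebesgue_tuple R n.+1.
have uV' : invmx V \in unitmx by rewrite unitmx_inv.
have := scales_volume_unitmx lm1 uV' (@measurable_std_simplex R n.+1).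
rewrite lebesgue_std_simplex// -cone_conv_hull (lebesgue_cone0 lm lm1); last first.
  exact: measurable_conv_hull.
(* The volume sought, divided by [n.+1] and by [|det V|], equals the inverse of [(n.+1)!]; it
   remains to solve for it. *)
rewrite det_inv normfV muleA -EFinM.
move/(congr1 (fun z => (`|\det V| * n.+1%:R)%:E * z)%E).
rewrite muleA -!EFinM mulrACA mulfV ?normr_eq0// mulfV// mulr1 mul1e => ->.
by congr EFin; rewrite factS natrM invfM mulrA mulfK// mulrC.
Qed.

End Barycentric.

(** [A] is known only by its membership condition, so that the lemma serves both a simplex under a
    barycentric coordinate and the region between [f] and [mu]. *)
Lemma lebesgue_between (n : nat) (m : {measure set (n.-tuple R) -> \bar R})
    (m1 : {measure set (n.+1.-tuple R) -> \bar R}) (J : set (n.-tuple R))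
    (g h : n.-tuple R -> R) A :
  is_lebesgue m -> is_lebesgue m1 -> measurable A ->
  (forall x y, A (ins ord_max y x) <-> J x /\ g x <= y <= h x) ->
  (forall x, J x -> g x <= h x) ->
  m1 A = (\int[m]_(x in J) (h x - g x)%:E)%E.
Proof.
move=> lm lm1 mA AE gh; rewrite (lebesgue_tuple_fubini2 lm lm1 ord_max mA).
rewrite [RHS]integral_mkcond; apply: eq_integral => x _; rewrite patchE.
case: ifPn; rewrite ?notin_setE ?inE => Jx; last first.
  by rewrite (_ : [set _ | _] = set0) ?measure0// -subset0 => y /= /AE[].
rewrite -[RHS]/((h x - g x)%:E) -[h x - g x]divr1 -[X in _ / X]normr1.
rewrite -(lebesgue_affine_preimage 0 (oner_neq0 R) (gh _ Jx)).
congr lebesgue_measure; apply/seteqP; split => y /=; rewrite mul1r addr0.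
  by case/AE.
by move=> ?; apply/AE.
Qed.

Section IntegralBary.
Variables (d : nat) (v : 'I_d.+1 -> d.-tuple R).
Hypothesis detV : \det (vertex_matrix v) != 0.
Variable j : 'I_d.+1.

(** The vertices of [v] at height 0, and one more vertex at height 1 above [v j]: their hull is the
    region below the [j]-th barycentric coordinate. *)
Let u (k : 'I_d.+2) : d.+1.-tuple R :=
  oapp (fun k => ins ord_max 0 (v k)) (ins ord_max 1 (v j)) (unlift ord_max k).

Let u_max : u ord_max = ins ord_max 1 (v j).
Proof. by rewrite /u unlift_none. Qed.

Let u_lift k : u (lift ord_max k) = ins ord_max 0 (v k).
Proof. by rewrite /u liftK. Qed.

Let det_u : `|\det (vertex_matrix u)| = `|\det (vertex_matrix v)|.
Proof.
have bumpN h k : (k < h)%N -> bump h k = k by rewrite /bump ltnNge => /negPf ->.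
(* The row of heights, of index [d]: its only nonzero entry is a 1 in the last column, and the minor
   there is the vertex matrix of [v]. The sign of the cofactor disappears in the absolute value. *)
pose r : 'I_d.+2 := lift ord_max ord_max.
rewrite (expand_det_row _ r) (bigD1_ord ord_max) //= big1 ?addr0 => [|k _].
  rewrite vertex_matrix_lift u_max tnth_ins mul1r /cofactor normrM normrX normrN1.
  rewrite expr1n mul1r; congr (`|\det _|); apply/matrixP => i k.
  rewrite 2!mxE; case: (unliftP ord_max i) => [i' ->|->].
    rewrite vertex_matrix_lift -(tnth_ins_lift ord_max 0 (v k) i') -u_lift.
    rewrite -vertex_matrix_lift; congr (vertex_matrix u _ _); apply/val_inj => /=.
    have i'd : (i' < d)%N by exact: ltn_ord.
    by rewrite (bumpN _ _ (ltnSn d)) !(bumpN _ _ i'd) (bumpN d.+1)// ltnW.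
  rewrite vertex_matrix_max -(vertex_matrix_max u (lift ord_max k)).
  by congr (vertex_matrix u _ _); apply/val_inj => /=; rewrite /bump ltnn leqnn.
by rewrite vertex_matrix_lift u_lift tnth_ins mul0r.
Qed.

Let conv_u x y : conv_hull u (ins ord_max y x) <->
  conv_hull v x /\ 0 <= y <= tnth (bary v x) j.
Proof.
split=> [[lam [lam0 lam1 xE]]|[Jx /andP[y0 yb]]].
  (* Forgetting the height merges the weight of the raised vertex into that of [v j]. *)
  pose l k := lam (lift ord_max k) + (if k == j then lam ord_max else 0).
  have l1 : \sum_k l k = 1.
    rewrite big_split /= -big_mkcond big_pred1_eq -lam1.
    by rewrite [RHS](bigD1_ord ord_max) //= addrC.
  have yE : y = lam ord_max.
    have := xE ord_max; rewrite tnth_ins (bigD1_ord ord_max) //= u_max tnth_ins mulr1.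
    by rewrite big1 ?addr0// => k _; rewrite u_lift tnth_ins mulr0.
  have xE' i : tnth x i = \sum_k l k * tnth (v k) i.
    have := xE (lift ord_max i); rewrite tnth_ins_lift => ->.
    rewrite (bigD1_ord ord_max) //= u_max tnth_ins_lift addrC.
    under [RHS]eq_bigr do rewrite mulrDl; rewrite big_split /=; congr (_ + _).
      by apply: eq_bigr => k _; rewrite u_lift tnth_ins_lift.
    rewrite (bigD1 j) //= eqxx big1 ?addr0// => k /negPf ->.
    by rewrite mul0r.
  rewrite (bary_unique detV l1 xE') yE lam0 /l eqxx lerDr lam0; split => //.
  exists l; split => // k; rewrite addr_ge0//.
  by case: ifP.
(* The height [y] is the weight of the raised vertex, and it is taken from the share of [v j]. *)
pose lam (k : 'I_d.+2) := oapp (fun k => tnth (bary v x) k - (if k == j then y else 0)) y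
  (unlift ord_max k).
have lmax : lam ord_max = y by rewrite /lam unlift_none.
have llift k : lam (lift ord_max k) = tnth (bary v x) k - (if k == j then y else 0).
  by rewrite /lam liftK.
have /(conv_hullP detV) b0 := Jx.
exists lam; split.
- apply/(forall_ord_lift ord_max); rewrite lmax; split => // k; rewrite llift.
  by case: eqVneq => [->|_]; rewrite ?subr0// subr_ge0.
- rewrite (bigD1_ord ord_max) //= lmax; under eq_bigr do rewrite llift.
  by rewrite sumrB sum_bary// -big_mkcond big_pred1_eq addrC subrK.
- apply/(forall_ord_lift ord_max); split => [|i].
    rewrite tnth_ins (bigD1_ord ord_max) //= lmax u_max tnth_ins mulr1.
    by rewrite big1 ?addr0// => k _; rewrite u_lift tnth_ins mulr0.
  rewrite tnth_ins_lift (bigD1_ord ord_max) //= lmax u_max tnth_ins_lift.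
  under eq_bigr do rewrite llift u_lift tnth_ins_lift mulrBl.
  rewrite sumrB -bary_comb// (bigD1 j) //= eqxx big1; first by rewrite addr0 addrC subrK.
  by move=> k /negPf ->; rewrite mul0r.
Qed.

Lemma integral_bary (m : {measure set (d.-tuple R) -> \bar R}) : is_lebesgue m ->
  (\int[m]_(x in conv_hull v) (tnth (bary v x) j)%:E =
   ((d.+1)`!%:R^-1 * `|\det (vertex_matrix v)|)%:E)%E.
Proof.
move=> lm; have [m1 lm1] := exists_lebesgue_tuple R d.+1.
have detu : \det (vertex_matrix u) != 0 by rewrite -normr_eq0 det_u normr_eq0.
rewrite -det_u -(lebesgue_conv_hull detu lm1).
rewrite (lebesgue_between lm lm1 (measurable_conv_hull detu) conv_u).
  by apply: eq_integral => x _; rewrite subr0.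
by move=> x /(conv_hullP detV).
Qed.

End IntegralBary.

End Simplices.

(** * Closed sets *)

Section Closed.
Variable R : realType.

Definition tclosed (n : nat) (A : set (n.-tuple R)) := tclosure A `<=` A.

Lemma sub_tclosure (n : nat) (A : set (n.-tuple R)) : A `<=` tclosure A.
Proof.
by move=> x Ax e e0; exists x; split => // i; rewrite subrr normr0.
Qed.

Lemma tclosureS (n : nat) (A B : set (n.-tuple R)) :
  A `<=` B -> tclosure A `<=` tclosure B.
Proof. by move=> AB x h e /h[q [/AB Bq qx]]; exists q. Qed.

(** The complement is the union of the boxes with rational centre and radius [k.+1%:R^-1] that it
    contains, and there are countably many of these. *)
Lemma measurable_tclosed (n : nat) (A : set (n.-tuple R)) :
  tclosed A -> measurable A.
Proof.
move=> cA; rewrite -[A]setCK; apply: measurableC.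
pose bx (p : n.-tuple rat * nat) : set (n.-tuple R) :=
  tbox [tuple ratr (tnth p.1 i) - p.2.+1%:R^-1 | i < n]
       [tuple ratr (tnth p.1 i) + p.2.+1%:R^-1 | i < n].
have -> : ~` A = \bigcup_p [set x | bx p `<=` ~` A /\ bx p x].
  apply/seteqP; split => [x /= nAx|x [p _ [pA px]]]; last exact: pA.
  have : ~ tclosure A x by move/cA.
  move=> /existsNP[e /not_implyP[e0 he]].
  (* With a radius below [e / 2], every point of a box containing [x] is within [e] of [x]. *)
  have [k hk] : exists k : nat, 0 + k.+1%:R^-1 < e / 2.
    by apply: ltr_add_invr; rewrite divr_gt0.
  rewrite add0r in hk.
  have hq i : exists q : rat, `|tnth x i - ratr q| <= k.+1%:R^-1.
    have [|q] := @rat_in_itvoo R (tnth x i - k.+1%:R^-1) (tnth x i + k.+1%:R^-1).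
      by rewrite ltrD2l (@lt_trans _ _ 0) ?invr_gt0// oppr_lt0 invr_gt0.
    rewrite in_itv /= => /andP[q1 q2]; exists q.
    by rewrite distrC ler_distl !ltW.
  have [q hq'] := choice hq.
  have bxE (y : n.-tuple R) : bx ([tuple q i | i < n], k) y <->
      forall i, `|tnth y i - ratr (q i)| <= k.+1%:R^-1.
    by split=> h i; have := h i; rewrite /= !tnth_mktuple ler_distl.
  exists ([tuple q i | i < n], k) => //; split; last exact/bxE.
  move=> y /bxE hy Ay; apply: he; exists y; split => // i.
  have -> : tnth x i - tnth y i = (tnth x i - ratr (q i)) - (tnth y i - ratr (q i)).
    by rewrite opprB addrA subrK.
  apply: le_lt_trans (ler_normB _ _) _; rewrite [e]splitr.
  by apply: ltrD; apply: le_lt_trans hk.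
apply: countable_bigcupT_measurable => // p.
have [h|h] := pselect (bx p `<=` ~` A).
  rewrite (_ : [set x | _] = bx p); first exact: measurable_tbox.
  by apply/seteqP; split => x //= [].
by rewrite (_ : [set x | _] = set0)// -subset0 => x /= [].
Qed.

Lemma tclosed_forall (n k : nat) (P : 'I_k -> set (n.-tuple R)) :
  (forall j, tclosed (P j)) -> tclosed [set x | forall j, P j x].
Proof.
by move=> cP x hx j; apply: cP; apply: tclosureS hx => y; apply.
Qed.

Lemma tclosed_ge0 (n : nat) (J : set (n.-tuple R)) g :
  tclosed J -> continuous_on_set J g -> tclosed [set x | J x /\ 0 <= g x].
Proof.
move=> cJ cg x hx.
have Jx : J x by apply: cJ; apply: tclosureS hx => y [].
split => //; rewrite leNgt; apply/negP => gx.
have [|dl dl0 h] := cg x Jx (- g x); first by rewrite oppr_gt0.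
have [q [[Jq gq] /(h _ Jq)]] := hx dl dl0.
by rewrite ltr_distlC addrN => /andP[_]; rewrite ltNge gq.
Qed.

Lemma continuous_on_setS (n : nat) (A B : set (n.-tuple R)) g :
  A `<=` B -> continuous_on_set B g -> continuous_on_set A g.
Proof.
move=> AB cg x /AB Bx e /(cg x Bx)[dl dl0 h].
by exists dl => // y /AB; exact: h.
Qed.

Lemma continuous_on_setB (n : nat) (A : set (n.-tuple R)) g h :
  continuous_on_set A g -> continuous_on_set A h ->
  continuous_on_set A (fun x => g x - h x).
Proof.
move=> cg ch x Ax e e0; have e2 : 0 < e / 2 by rewrite divr_gt0.
have [d1 d10 h1] := cg x Ax _ e2; have [d2 d20 h2] := ch x Ax _ e2.
exists (Num.min d1 d2); first by rewrite lt_min d10.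
move=> y Ay xy; have xy1 i : `|tnth x i - tnth y i| < d1.
  by apply: lt_le_trans (xy i) _; rewrite ge_min lexx.
have xy2 i : `|tnth x i - tnth y i| < d2.
  by apply: lt_le_trans (xy i) _; rewrite ge_min lexx orbT.
have -> : g x - h x - (g y - h y) = (g x - g y) - (h x - h y).
  by ring.
apply: le_lt_trans (ler_normB _ _) _; rewrite [e]splitr.
by rewrite ltrD// ?h1// h2.
Qed.

Lemma continuous_on_set_lin (n : nat) (A : set (n.-tuple R)) (c : 'I_n -> R) b :
  continuous_on_set A (fun x => \sum_(i < n) c i * tnth x i + b).
Proof.
(* The added 1 keeps [K] positive when all coefficients vanish. *)
move=> x _ e e0; pose K := 1 + \sum_(i < n) `|c i|.
have K0 : 0 < K by rewrite ltr_pwDl// sumr_ge0.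
exists (e / K); first by rewrite divr_gt0.
move=> y _ xy; rewrite opprD addrACA subrr addr0 -sumrB.
apply: le_lt_trans (ler_norm_sum _ _ _) _.
apply: (@le_lt_trans _ _ (\sum_(i < n) `|c i| * (e / K))).
  by apply: ler_sum => i _; rewrite -mulrBr normrM ler_wpM2l// ltW.
rewrite -mulr_suml mulrCA gtr_pMr// ltr_pdivrMr// mul1r /K.
by rewrite ltrDr.
Qed.

(** Within the closed set [J], the preimage of a ray closed on the left is closed, hence
    measurable. *)
Lemma measurable_fun_continuous_on (n : nat) (J : set (n.-tuple R)) g :
  tclosed J -> continuous_on_set J g -> measurable_fun J g.
Proof.
move=> cJ cg; apply: (measurability _ (RGenCInfty.measurableE R)).
move=> _ [_ [a ->] <-].
have : tclosed [set x | J x /\ 0 <= g x - a].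
  apply: tclosed_ge0 => //; apply: continuous_on_setB => //.
  move=> x _ e e0; exists 1 => // y _ _; by rewrite subrr normr0.
move/measurable_tclosed; congr measurable.
by apply/seteqP; split => x /=; rewrite in_itv /= andbT subr_ge0.
Qed.

Lemma tclosed_conv_hull (n : nat) (w : 'I_n.+1 -> n.-tuple R) :
  \det (vertex_matrix w) != 0 -> tclosed (conv_hull w).
Proof.
move=> dw; rewrite (_ : conv_hull w =
    [set x | forall j, setT x /\ 0 <= tnth (bary w x) j]).
  apply: tclosed_forall => j; apply: tclosed_ge0 => //.
  rewrite (_ : (fun x => _) = fun x => \sum_(i < n) invmx (vertex_matrix w) j
      (lift ord_max i) * tnth x i + invmx (vertex_matrix w) j ord_max).
    exact: continuous_on_set_lin.
  by apply/funext => x; rewrite tnth_bary.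
apply/seteqP; split => x; first by move/(conv_hullP dw) => h j; split.
by move=> h; apply/(conv_hullP dw) => j; case: (h j).
Qed.

Definition tinit (n : nat) (p : n.+1.-tuple R) : n.-tuple R :=
  [tuple tnth p (lift ord_max i) | i < n].

Lemma tinit_ins (n : nat) y (x : n.-tuple R) : tinit (ins ord_max y x) = x.
Proof. by apply: eq_from_tnth => i; rewrite tnth_mktuple tnth_ins_lift. Qed.

Definition between (n : nat) (J : set (n.-tuple R)) (g h : n.-tuple R -> R) :
    set (n.+1.-tuple R) :=
  [set p | J (tinit p) /\ g (tinit p) <= tnth p ord_max <= h (tinit p)].

Lemma between_ins (n : nat) (J : set (n.-tuple R)) g h x y :
  between J g h (ins ord_max y x) <-> J x /\ g x <= y <= h x.
Proof. by rewrite /between /= tinit_ins tnth_ins. Qed.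

Lemma tclosed_between (n : nat) (J : set (n.-tuple R)) g h :
  tclosed J -> continuous_on_set J g -> continuous_on_set J h ->
  tclosed (between J g h).
Proof.
move=> cJ cg ch.
pose J' := [set p : n.+1.-tuple R | J (tinit p)].
have cJ' : tclosed J'.
  move=> p hp; apply: cJ => e /hp[q [Jq pq]]; exists (tinit q); split => // i.
  by rewrite !tnth_mktuple.
have c_init k : continuous_on_set J k -> continuous_on_set J' (fun p => k (tinit p)).
  move=> ck p Jp e /(ck _ Jp)[dl dl0 hk]; exists dl => // q Jq pq.
  by apply: hk => // i; rewrite !tnth_mktuple.
have c_last : continuous_on_set J' (fun p => tnth p ord_max).
  by move=> p _ e e0; exists e.
rewrite (_ : between J g h = [set p |
    [set p | J' p /\ 0 <= h (tinit p) - tnth p ord_max] p /\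
    0 <= tnth p ord_max - g (tinit p)]).
  apply: tclosed_ge0.
    by apply: tclosed_ge0 => //; apply: continuous_on_setB => //; exact: c_init.
  apply: (@continuous_on_setS _ _ J'); first by move=> p [].
  by apply: continuous_on_setB => //; exact: c_init.
apply/seteqP; split => p /=; rewrite !subr_ge0.
  by move=> [Jp /andP[]].
by move=> [[Jp h1] h2]; split => //; apply/andP.
Qed.

Definition tbounded (n : nat) (A : set (n.-tuple R)) (K : R) :=
  forall x, A x -> forall i, `|tnth x i| <= K.

(** A point at height [t] has its other coordinates bounded by [t * K], so a limit at height 0 is
    the origin; nonemptiness of [Q] makes the origin a limit. At a limit of height [z > 0], dividing
    by [z] gives a point close to [Q]. *)
Lemma tclosure_cone (n : nat) (Q : set (n.-tuple R)) K :
  tclosed Q -> tbounded Q K -> 0 <= K -> Q !=set0 ->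
  tclosure (cone Q) = cone Q `|` [set tzero R n.+1].
Proof.
move=> cQ bQ K0 [q0 Qq0].
have K1 : 0 < 1 + K by rewrite ltr_pwDl.
apply/seteqP; split => p; last first.
  case; first exact: sub_tclosure.
  move=> -> e e0; pose z := Num.min 1 (e / (1 + K) / 2).
  have e1 : 0 < e / (1 + K) / 2 by rewrite !divr_gt0.
  have z0 : 0 < z by rewrite lt_min ltr01.
  have z1 : z <= 1 by rewrite ge_min lexx.
  have ze : z * (1 + K) < e.
    rewrite -ltr_pdivlMr//; apply: (@le_lt_trans _ _ (e / (1 + K) / 2)).
      by rewrite ge_min lexx orbT.
    by rewrite gtr_pMr ?divr_gt0// invf_lt1// ltr1n.
  exists (ins ord_max z (tscale z q0)); split.
    apply/cone_ins; rewrite z0 z1; split => //.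
    rewrite (_ : tscale _ _ = q0)//; apply: eq_from_tnth => i.
    by rewrite !tnth_mktuple mulrA mulVf ?mul1r// gt_eqF.
  apply/(forall_ord_lift ord_max); split => [|i].
    rewrite tnth_ins tnth_mktuple sub0r normrN gtr0_norm//; apply: le_lt_trans ze.
    by rewrite ler_peMr ?(ltW z0)// lerDl.
  rewrite tnth_ins_lift !tnth_mktuple sub0r normrN normrM gtr0_norm//.
  apply: le_lt_trans ze; rewrite ler_pM2l//.
  by apply: le_trans (bQ _ Qq0 i) _; rewrite lerDr.
move=> hp; pose z := tnth p ord_max.
have approx e : 0 < e -> exists t w, [/\ 0 < t <= 1, Q w, `|z - t| < e &
    forall i, `|tnth p (lift ord_max i) - t * tnth w i| < e].
  move=> /hp[q [+ pq]]; rewrite [q]ins_maxE => /cone_ins[t01 Qw].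
  eexists; eexists; split; [exact: t01|exact: Qw|exact: pq|move=> i].
  rewrite !tnth_mktuple mulrA mulfV ?mul1r//.
  by case/andP: t01 => t0 _; rewrite gt_eqF.
have z0 : 0 <= z.
  apply/ler_addgt0Pr => e /approx[t [w [/andP[t0 _] _ + _]]].
  by rewrite ltr_distlC => /andP[_ h]; apply/ltW/(lt_trans t0).
have z1 : z <= 1.
  apply/ler_addgt0Pr => e /approx[t [w [/andP[_ t1] _ + _]]].
  by rewrite distrC ltr_distlC => /andP[_ h]; apply/ltW/(lt_le_trans h); rewrite lerD2r.
rewrite [p]ins_maxE -/z; move: z0; rewrite le_eqVlt => /predU1P[z0|z0].
  right => /=; rewrite -z0.
  apply: eq_from_tnth; apply/(forall_ord_lift ord_max); split => [|i].
    by rewrite tnth_ins tnth_mktuple.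
  rewrite tnth_ins_lift !tnth_mktuple; apply/eqP; rewrite -normr_le0.
  apply/ler_addgt0Pr => e e0; rewrite add0r.
  have [|t [w [/andP[t0 _] Qw zt pw]]] := approx (e / (1 + K)); first by rewrite divr_gt0.
  have {}zt : t <= e / (1 + K) by move: zt; rewrite -z0 sub0r normrN gtr0_norm// => /ltW.
  rewrite -[tnth p _](subrK (t * tnth w i)); apply: le_trans (ler_normD _ _) _.
  have -> : e = e / (1 + K) + e / (1 + K) * K.
    by rewrite -[X in _ = X + _]mulr1 -mulrDr divfK// gt_eqF.
  apply: lerD; first exact/ltW/pw.
  by rewrite normrM (gtr0_norm t0) ler_pM//; [exact: ltW|exact: bQ].
left; apply/cone_ins; rewrite z0 z1; split => //; apply: cQ => e e0.
(* Replacing the height [t] of the approximating point by [z] costs up to [K] times the tolerance,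
   besides the tolerance itself; the total is [e * z], that is [e] after division by [z]. *)
have [|t [w [/andP[t0 _] Qw zt pw]]] := approx (e * z / (1 + K)).
  by rewrite divr_gt0// mulr_gt0.
exists w; split => // i; rewrite !tnth_mktuple.
rewrite -(@ltr_pM2r _ z)// -{2}(gtr0_norm z0) -normrM mulrBl mulrAC mulVf ?gt_eqF// mul1r.
have -> : tnth p (lift ord_max i) - tnth w i * z =
    (tnth p (lift ord_max i) - t * tnth w i) - (z - t) * tnth w i.
  by rewrite mulrBl opprB addrA subrK mulrC.
apply: le_lt_trans (ler_normB _ _) _.
have -> : e * z = e * z / (1 + K) + e * z / (1 + K) * K.
  by rewrite -[X in _ = X + _]mulr1 -mulrDr divfK// gt_eqF.
apply: ltr_leD; first exact: pw.
by rewrite normrM ler_pM//; [exact: ltW|exact: bQ].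
Qed.

End Closed.

(** * Convex functions on a simplex *)

Section ConvexOnSimplex.
Variable R : realType.

Lemma conv_hull_vertex (d : nat) (v : 'I_d.+1 -> d.-tuple R) j : conv_hull v (v j).
Proof.
exists (fun k => (k == j)%:R); split => [k||i]; first exact: ler0n.
  by rewrite (bigD1 j) //= eqxx big1 ?addr0// => k /negPf ->.
rewrite (bigD1 j) //= eqxx mul1r big1 ?addr0// => k /negPf ->.
by rewrite mul0r.
Qed.

Lemma conv_hull_tcomb (d : nat) (v : 'I_d.+1 -> d.-tuple R) x y t :
  conv_hull v x -> conv_hull v y -> 0 <= t <= 1 -> conv_hull v (tcomb t x y).
Proof.
move=> [l [l0 l1 lE]] [l' [l'0 l'1 l'E]] /andP[t0 t1].
exists (fun j => t * l j + (1 - t) * l' j); split => [j||i].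
- by rewrite addr_ge0// mulr_ge0// subr_ge0.
- by rewrite big_split /= -!mulr_sumr l1 l'1 !mulr1 addrC subrK.
- rewrite tnth_mktuple lE l'E !mulr_sumr -big_split /=.
  by apply: eq_bigr => j _; rewrite [RHS]mulrDl !mulrA.
Qed.

(** Passes from two-point convexity to all vertices, by induction on the number of nonzero weights:
    one vertex is split off and the remaining weights are divided by their sum [1 - l j], unless
    that sum is 0 and the point is the vertex. *)
Lemma conv_hull_min (d : nat) (v : 'I_d.+1 -> d.-tuple R) (C : set (d.-tuple R)) :
  (forall x y t, C x -> C y -> 0 <= t <= 1 -> C (tcomb t x y)) ->
  (forall j, C (v j)) -> conv_hull v `<=` C.
Proof.
move=> Cc Cv x [l [l0 l1 lE]].
have [k] := ubnP #|[pred j | l j != 0]|.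
elim: k => // k IHk in l x l0 l1 lE *; rewrite ltnS => cl.
have [j lj] : exists j, l j != 0.
  apply: contrapT => hn; move: l1; rewrite big1.
    by move/esym/eqP; rewrite oner_eq0.
  by move=> i _; apply/eqP/negP => /negP li; apply: hn; exists i.
have sE : 1 - l j = \sum_(i < d.+1 | i != j) l i.
  by rewrite -l1 (bigD1 j) //= addrAC subrr add0r.
have [lj1|lj1] := eqVneq (l j) 1.
  suff -> : x = v j by [].
  have li0 i : i != j -> l i = 0.
    move=> ij; move/esym/eqP: sE; rewrite lj1 subrr psumr_eq0// => /allP.
    by move=> /(_ i (mem_index_enum _)) /implyP /(_ ij) /eqP.
  apply: eq_from_tnth => i; rewrite lE (bigD1 j) //= big1 ?addr0 ?lj1 ?mul1r//.
  by move=> k' /li0 ->; rewrite mul0r.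
have lj_le1 : l j <= 1 by rewrite -subr_ge0 sE sumr_ge0.
have lj1' : 1 - l j != 0 by rewrite subr_eq0 eq_sym.
pose l' i := if i == j then 0 else l i / (1 - l j).
pose y := [tuple \sum_i' l' i' * tnth (v i') i | i < d].
have -> : x = tcomb (l j) (v j) y.
  apply: eq_from_tnth => i; rewrite !tnth_mktuple lE (bigD1 j) //=; congr (_ + _).
  rewrite mulr_sumr [RHS](bigD1 j) //= /l' eqxx mul0r mulr0 add0r.
  apply: eq_bigr => i' /negPf ->.
  by rewrite mulrA mulrCA mulfV// mulr1.
apply: Cc => //; last by rewrite l0.
apply: (IHk l') => [i|||].
- by rewrite /l'; case: ifP => // _; rewrite divr_ge0// subr_ge0.
- rewrite (bigD1 j) //= {1}/l' eqxx add0r.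
  rewrite (eq_bigr (fun i => l i / (1 - l j))); last first.
    by move=> i /negPf ij; rewrite /l' ij.
  by rewrite -mulr_suml -sE mulfV.
- by move=> i; rewrite tnth_mktuple.
- apply: leq_trans cl; apply: proper_card; apply/properP; split.
    apply/fintype.subsetP => i; rewrite !inE /l'.
    case: (eqVneq i j) => [->|_]; first by rewrite eqxx.
    by apply: contra => /eqP ->; rewrite mul0r.
  by exists j; rewrite !inE// /l' !eqxx.
Qed.

Lemma tbounded_conv_hull (d : nat) (v : 'I_d.+1 -> d.-tuple R) :
  tbounded (conv_hull v) (\sum_j \sum_i `|tnth (v j) i|).
Proof.
move=> x [l [l0 l1 lE]] i; rewrite lE.
apply: le_trans (ler_norm_sum _ _ _) _; apply: ler_sum => j _.
have lj1 : l j <= 1 by rewrite -l1 (bigD1 j) //= lerDl sumr_ge0.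
rewrite normrM (ger0_norm (l0 j)); apply: le_trans (ler_piMl _ lj1) _ => //.
by rewrite (bigD1 i) //= lerDl sumr_ge0.
Qed.

Lemma affine_comb (d : nat) (mu : d.-tuple R -> R) (v : 'I_d.+1 -> d.-tuple R)
    (l : 'I_d.+1 -> R) x : affine_fun mu -> \sum_j l j = 1 ->
  (forall i, tnth x i = \sum_j l j * tnth (v j) i) -> mu x = \sum_j l j * mu (v j).
Proof.
move=> [c [b muE]] l1 xE; rewrite muE.
under [RHS]eq_bigr do rewrite muE mulrDr mulr_sumr.
rewrite big_split /= -mulr_suml l1 mul1r exchange_big /=; congr (_ + _).
apply: eq_bigr => i _; rewrite xE mulr_sumr.
by apply: eq_bigr => j _; rewrite mulrCA.
Qed.

Lemma affine_tcomb (d : nat) (mu : d.-tuple R -> R) x y t : affine_fun mu ->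
  mu (tcomb t x y) = t * mu x + (1 - t) * mu y.
Proof.
move=> [c [b muE]]; rewrite !muE.
have -> : \sum_(i < d) tnth c i * tnth (tcomb t x y) i =
    t * (\sum_(i < d) tnth c i * tnth x i) + (1 - t) * (\sum_(i < d) tnth c i * tnth y i).
  rewrite !mulr_sumr -big_split /=; apply: eq_bigr => i _.
  by rewrite tnth_mktuple mulrDr; congr (_ + _); rewrite mulrCA.
ring.
Qed.

Lemma continuous_on_set_affine (d : nat) (mu : d.-tuple R -> R) A :
  affine_fun mu -> continuous_on_set A mu.
Proof.
move=> [c [b muE]]; rewrite (_ : mu = fun x => \sum_(i < d) tnth c i * tnth x i + b).
  exact: continuous_on_set_lin.
exact/funext.
Qed.

(** The part of the simplex where [f <= mu] is convex and contains the vertices. *)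
Lemma convex_le_affine (d : nat) (v : 'I_d.+1 -> d.-tuple R) f mu :
  convex_on_set (conv_hull v) f -> affine_fun mu ->
  (forall j, f (v j) <= mu (v j)) -> forall x, conv_hull v x -> f x <= mu x.
Proof.
move=> cf amu fmu x Jx.
suff : [set x | conv_hull v x /\ f x <= mu x] x by case.
apply: conv_hull_min Jx => [y z t [Jy fy] [Jz fz] t01|j]; last first.
  by split; [exact: conv_hull_vertex|exact: fmu].
split; first exact: conv_hull_tcomb.
apply: le_trans (cf _ _ _ Jy Jz t01) _; rewrite affine_tcomb//.
case/andP: t01 => t0 t1.
by rewrite lerD// ler_wpM2l// subr_ge0.
Qed.

(* Every point of the simplex lies on a segment through the barycentre whose
   other end is in the simplex too, so an upper bound gives a lower bound. *)
Lemma convex_lower_bound (d : nat) (v : 'I_d.+1 -> d.-tuple R) f M :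
  convex_on_set (conv_hull v) f -> (forall x, conv_hull v x -> f x <= M) ->
  exists K, forall x, conv_hull v x -> K <= f x.
Proof.
move=> cf fM.
(* Since [t] is at most [d.+1%:R^-1], the barycentre minus [t] times [x] keeps nonnegative weights.
   The value [d.+1%:R^-1] itself would give [t = 1] when [d = 0]. *)
pose t : R := d.+2%:R^-1.
have t0 : 0 < t by rewrite invr_gt0.
have t1 : t < 1 by rewrite invf_lt1// ltr1n.
have t1' : 0 < 1 - t by rewrite subr_gt0.
pose c := [tuple \sum_j d.+1%:R^-1 * tnth (v j) i | i < d].
(* Obtained by solving [f c <= t * f x + (1 - t) * M] for [f x]. *)
exists ((f c - (1 - t) * M) / t) => x Jx; have [l [l0 l1 lE]] := Jx.
pose l' j := (d.+1%:R^-1 - t * l j) / (1 - t).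
pose x' := [tuple \sum_j l' j * tnth (v j) i | i < d].
have Jx' : conv_hull v x'.
  exists l'; split => [j||i]; last by rewrite tnth_mktuple.
    rewrite divr_ge0 ?(ltW t1')// subr_ge0 (@le_trans _ _ t)//.
      rewrite ler_piMr ?(ltW t0)//.
      by rewrite -l1 (bigD1 j) //= lerDl sumr_ge0.
    by rewrite /t lef_pV2 ?posrE// ler_nat.
  rewrite -mulr_suml sumrB -mulr_sumr l1 mulr1 sumr_const card_ord.
  by rewrite -[X in X - t]mulr_natl mulfV// mulfV// gt_eqF.
have cE : c = tcomb t x x'.
  apply: eq_from_tnth => i; rewrite !tnth_mktuple lE !mulr_sumr -big_split /=.
  apply: eq_bigr => j _; rewrite !mulrA -mulrDl; congr (_ * _).
  by rewrite [(1 - t) * _]mulrC mulfK ?gt_eqF// addrC subrK.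
rewrite ler_pdivrMr// lerBlDr mulrC cE.
apply: le_trans (cf _ _ _ Jx Jx' _) _; first by rewrite !ltW.
by rewrite lerD2l ler_pM2l// fM.
Qed.

(** Dividing the constraints by [z > 0] turns them into membership of [(x / z, y / z)] in the region
    between [f] and [mu]. *)
Lemma persp_relax_cone (d : nat) (f mu : d.-tuple R -> R) J :
  persp_relax f mu J = tclosure (cone (between J f mu)).
Proof.
rewrite /persp_relax; congr tclosure.
have ptE (x : d.-tuple R) y z : pt x y z = ins ord_max z (ins ord_max y x).
  apply: eq_from_tnth; apply/(forall_ord_lift ord_max); split.
    by rewrite tnth_ins tnth_mktuple /= ltnNge leqnSn /= gtn_eqF.
  apply/(forall_ord_lift ord_max); split => [|i].
    by rewrite tnth_ins_lift tnth_ins tnth_mktuple lift_max /= ltnn eqxx.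
  rewrite !tnth_ins_lift tnth_mktuple !lift_max ltn_ord.
  by rewrite (tnth_nth 0).
have scE z y (x : d.-tuple R) :
    tscale z^-1 (ins ord_max y x) = ins ord_max (z^-1 * y) (tscale z^-1 x).
  apply: eq_from_tnth; apply/(forall_ord_lift ord_max); split => [|i].
    by rewrite tnth_ins tnth_mktuple tnth_ins.
  by rewrite tnth_ins_lift tnth_mktuple tnth_ins_lift tnth_mktuple.
have scK z (x : d.-tuple R) : 0 < z -> tscale z^-1 (tscale z x) = x.
  move=> z0; apply: eq_from_tnth => i.
  by rewrite !tnth_mktuple mulrA mulVf ?mul1r// gt_eqF.
have scKV z (x : d.-tuple R) : 0 < z -> tscale z (tscale z^-1 x) = x.
  move=> z0; apply: eq_from_tnth => i.
  by rewrite !tnth_mktuple mulrA mulfV ?mul1r// gt_eqF.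
apply/seteqP; split => p.
  move=> [x [y [z [-> ymu fy [x' Jx' xE] z01]]]].
  have /andP[z0 z1] := z01.
  rewrite ptE; apply/cone_ins; split => //; rewrite scE; apply/between_ins.
  rewrite ler_pdivlMl// ler_pdivrMl// fy ymu; split => //.
  by rewrite -xE scK.
rewrite [p]ins_maxE; move: (tnth p ord_max) [tuple _ | _ < _] => z q.
rewrite [q]ins_maxE; move: (tnth q ord_max) [tuple _ | _ < _] => y x.
move=> /cone_ins [z01]; rewrite scE => /between_ins [Jx].
have /andP[z0 z1] := z01.
rewrite ler_pdivlMl// ler_pdivrMl// => /andP[fy ymu].
exists x, y, z; rewrite ptE; split => //.
by exists (tscale z^-1 x) => //; rewrite scKV.
Qed.

(** On the simplex [mu] is the combination of the barycentric coordinates with coefficients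
    [mu (v j)], and these coordinates all have the same integral. *)
Lemma integral_affine_conv_hull (d : nat) (v : 'I_d.+1 -> d.-tuple R)
    (mu : d.-tuple R -> R) (m : {measure set (d.-tuple R) -> \bar R}) :
  is_lebesgue m -> \det (vertex_matrix v) != 0 -> affine_fun mu ->
  (\int[m]_(x in conv_hull v) (mu x)%:E =
   ((d.+1)`!%:R^-1 * `|\det (vertex_matrix v)| * \sum_j mu (v j))%:E)%E.
Proof.
move=> lm detV amu.
have mJ := measurable_conv_hull detV.
have ib j : m.-integrable (conv_hull v) (fun x => (tnth (bary v x) j)%:E).
  apply/integrableP; split.
    apply/measurable_EFinP; apply: measurable_fun_continuous_on.
      exact: tclosed_conv_hull.
    rewrite (_ : (fun x => _) = fun x => \sum_(i < d) invmx (vertex_matrix v) j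
        (lift ord_max i) * tnth x i + invmx (vertex_matrix v) j ord_max).
      exact: continuous_on_set_lin.
    by apply/funext => x; rewrite tnth_bary.
  rewrite (eq_integral (fun x => (tnth (bary v x) j)%:E)).
    by rewrite integral_bary// ltry.
  move=> x; rewrite inE => /(conv_hullP detV) h.
  by rewrite gee0_abs// lee_fin.
rewrite (eq_integral (fun x => \sum_j (mu (v j))%:E * (tnth (bary v x) j)%:E)%E).
  rewrite integral_sum//; last by move=> j; exact: integrableZl.
  under eq_bigr do rewrite integralZl// integral_bary// -EFinM.
  by rewrite sumEFin -mulr_suml mulrC.
move=> x _; rewrite (affine_comb amu (sum_bary detV x) (bary_comb detV x)).
by rewrite -sumEFin; apply: eq_bigr => j _; rewrite -EFinM mulrC.
Qed.

End ConvexOnSimplex.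

Theorem theorem1 (R : realType) (d : nat) (v : 'I_d.+1 -> d.-tuple R)
  (f mu : d.-tuple R -> R)
  (lam_d : {measure set (d.-tuple R) -> \bar R})
  (lam_d2 : {measure set (d.+2.-tuple R) -> \bar R}) :
  is_lebesgue lam_d -> is_lebesgue lam_d2 ->
  (* J is a d-simplex: its vertices are affinely independent *)
  \det (vertex_matrix v) != 0 ->
  (* J is contained in R^d_{>=0} \ {0} *)
  (forall x, conv_hull v x -> (forall i, 0 <= tnth x i) /\ x <> [tuple 0 | _ < d]) ->
  continuous_on_set (conv_hull v) f ->
  convex_on_set (conv_hull v) f ->
  (* mu is the affine function agreeing with f at the vertices *)
  affine_fun mu -> (forall j, mu (v j) = f (v j)) ->
  lam_d2 (persp_relax f mu (conv_hull v)) =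
    ((((d.+2)`!%:R)^-1 * `|\det (vertex_matrix v)| * \sum_(j < d.+1) f (v j))%:E
     - (((d.+2)%:R)^-1)%:E * \int[lam_d]_(x in conv_hull v) (f x)%:E)%E.
Proof.
move=> ld ld2 detV _ cf cvf amu muv.
have [m1 lm1] := exists_lebesgue_tuple R d.+1.
set J := conv_hull v.
have cJ : tclosed J by exact: tclosed_conv_hull.
have mJ : measurable J by exact: measurable_conv_hull.
have cmu : continuous_on_set J mu by exact: continuous_on_set_affine.
have fmu x : J x -> f x <= mu x.
  by apply: convex_le_affine => // j; rewrite muv.
pose M := \sum_j `|f (v j)|.
have M0 : 0 <= M by exact: sumr_ge0.
have muM x : J x -> `|mu x| <= M.
  move=> [l [l0 l1 lE]]; rewrite (affine_comb amu l1 lE).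
  apply: le_trans (ler_norm_sum _ _ _) _; apply: ler_sum => j _.
  have lj1 : l j <= 1 by rewrite -l1 (bigD1 j) //= lerDl sumr_ge0.
  by rewrite muv normrM (ger0_norm (l0 j)) ler_piMl.
(* The lower bound on [f] serves twice: for the boundedness of [Q] and for the integrability of
   [f]. *)
have [K' fK'] : exists K, forall x, J x -> K <= f x.
  apply: (convex_lower_bound cvf (M := M)) => x Jx; apply: le_trans (fmu _ Jx) _.
  by apply: le_trans (muM _ Jx); exact: ler_norm.
pose K := M + `|K'|.
have MK : M <= K by rewrite lerDl.
have K0 : 0 <= K by apply: le_trans MK.
have fK x y : J x -> f x <= y <= mu x -> `|y| <= K.
  move=> Jx /andP[fy ymu]; rewrite ler_norml; apply/andP; split.
    apply: le_trans fy; apply: le_trans (fK' _ Jx); rewrite lerNl.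
    by apply: (@le_trans _ _ `|K'|); rewrite ?lerDr// -normrN ler_norm.
  apply: le_trans ymu _; apply: le_trans MK.
  by apply: le_trans (muM _ Jx); exact: ler_norm.
set Q := between J f mu.
have cQ : tclosed Q by exact: tclosed_between.
have J0 : J !=set0 by exists (v ord0); exact: conv_hull_vertex.
have mQ : measurable Q by exact: measurable_tclosed.
have Q0 : Q !=set0.
  have [x Jx] := J0; exists (ins ord_max (f x) x); apply/between_ins.
  by rewrite lexx fmu.
pose B := K + \sum_j \sum_i `|tnth (v j) i|.
have S0 : 0 <= \sum_j \sum_i `|tnth (v j) i| by apply: sumr_ge0 => j _; exact: sumr_ge0.
have bQ : tbounded Q B.
  move=> p [Jp fp]; apply/(forall_ord_lift ord_max); split => [|i].
    by apply: le_trans (fK _ _ Jp fp) _; rewrite lerDl.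
  have := tbounded_conv_hull Jp i; rewrite tnth_mktuple => /le_trans; apply.
  by rewrite lerDr.
rewrite persp_relax_cone (tclosure_cone cQ bQ) ?addr_ge0//.
rewrite (lebesgue_cone0 lm1 ld2 mQ).
rewrite (lebesgue_between ld lm1 mQ (@between_ins R d J f mu) fmu).
have Joo : (lam_d J < +oo)%E by rewrite lebesgue_conv_hull// ltry.
have intJ g : continuous_on_set J g -> (forall x, J x -> `|g x| <= K) ->
    lam_d.-integrable J (EFin \o g).
  move=> cg gK; apply: measurable_bounded_integrable => //.
    exact: measurable_fun_continuous_on.
  exists K; split; first exact: num_real.
  by move=> N KN x Jx; apply: le_trans (gK _ Jx) (ltW KN).
have If : lam_d.-integrable J (EFin \o f).
  by apply: intJ => // x Jx; apply: (fK x) => //; rewrite lexx fmu.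
have Imu : lam_d.-integrable J (EFin \o mu).
  by apply: intJ => // x Jx; apply: le_trans (muM _ Jx) MK.
under eq_integral do rewrite EFinB.
rewrite integralB_EFin// (integral_affine_conv_hull ld detV amu).
(* The integral of [f] is finite, so the rest is arithmetic of reals: [d.+2%:R^-1] times the inverse
   of [(d.+1)!] is the inverse of [(d.+2)!]. *)
rewrite -(fineK (integrable_fin_num mJ If)) -EFinB -!EFinM -EFinB.
congr EFin; rewrite mulrBr; congr (_ - _).
rewrite (eq_bigr _ (fun j _ => muv j)) !mulrA -invfM -natrM.
by rewrite -factS.
Qed.
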